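(* Let $m,n\ge1$, $\lambda>1$, and let $B_1\in\mathbb{R}^{n\times m}$, $B_2\in\mathbb{R}^{n\times n}$ satisfy $\operatorname{rank}[B_1,B_2B_1,\dots,B_2^{n-1}B_1]=n$. There exist constants $C\ge1$, $\alpha_0>1$ and $c_0,\varepsilon_0\in(0,1)$ (sufficiently small), depending only on $\lambda,m,n,B_1,B_2$, such that the following holds. Let $T>0$ and let $A(t,v)=(a_{ij}(t,v))_{1\le i,j\le m}$ be a real matrix with $a_{ij}=a_{ji}\in C^{0,1}((0,T)\times\mathbb{R}^m)$, $\lambda^{-1}|\xi|^2\le\sum_{i,j}a_{ij}(t,v)\xi_i\xi_j\le\lambda|\xi|^2$ for all $(t,v)\in(0,T)\times\mathbb{R}^m$ and $\xi\in\mathbb{R}^m$, and $|\partial_ta_{ij}|+|\nabla_va_{ij}|\le\lambda$ for $1\le i,j\le m$. Let $\alpha,t_2,b$ satisfy $$\alpha\ge\alpha_0,\qquad0<t_2\le\min\{c_0\lambda^{-2},T\},\qquad0<b\le t_2,$$ and let $\rho\in\mathbb{R}^n$ be such that $$\sup_{0<t<t_2}(t+b)^3\left|B_1^Te^{-tB_2^T}\rho\right|^2\le\varepsilon_0\alpha.$$ Define $$\widetilde{P}_\rho=\partial_t+i\left(B_1^Te^{-tB_2^T}\rho\right)\cdot v+\operatorname{div}_v\left(A(t,v)\nabla_v\,\cdot\,\right)-\tfrac12\operatorname{tr}B_2 .$$ Then for every $h\in C_c^\infty((0,t_2)\times\mathbb{R}^m)$ (complex-valued), $$\int_0^{t_2}\!\!\int_{\mathbb{R}^m}(t+b)^{-2\alpha}|\nabla_vh|^2\,dv\,dt+\alpha\int_0^{t_2}\!\!\int_{\mathbb{R}^m}(t+b)^{-2\alpha-1}|h|^2\,dv\,dt\le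 C\int_0^{t_2}\!\!\int_{\mathbb{R}^m}(t+b)^{-2\alpha+1}|\widetilde{P}_\rho h|^2\,dv\,dt.$$
   Context: $B^T$ denotes the transpose and $\operatorname{tr}$ the trace. Derivatives of the Lipschitz functions $a_{ij}$ exist a.e. and the bounds on them are understood a.e. *)

(* Defs.v *)
From HB Require Import structures.
From mathcomp Require Import all_boot all_order all_algebra.
From mathcomp Require Import complex.
From mathcomp Require Import all_classical all_reals all_analysis.

Set Implicit Arguments.
Unset Strict Implicit.
Unset Printing Implicit Defensive.

Import Order.TTheory GRing.Theory Num.Theory.
Import numFieldNormedType.Exports.

Local Open Scope classical_set_scope.
Local Open Scope ring_scope.

(* MathComp-Analysis has Lebesgue measure on R only: on R^n it is built here by
   iterating the binary product. The carrier is the type of n-tuples, which has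
   the product sigma-algebra; [row_of_tuple] transports it to the normed space
   'rV_n. The mathcomp norm on 'rV_n is the sup norm, so all Euclidean norms are
   written out as (square roots of) sums of squares. *)

Section lebesgue_tuple.
Context {R : realType}.
Local Notation leb := (@lebesgue_measure R).
Local Notation tupR n := (n.-tuple (measurableTypeR R)).

Definition cons_tup (n : nat) (p : measurableTypeR R * tupR n) : tupR n.+1 :=
  [the n.+1.-tuple _ of p.1 :: p.2].

Lemma measurable_cons_tup n : measurable_fun setT (@cons_tup n).
Proof. exact: measurable_cons. Qed.

Definition lebesgue_consT n (mu : {sigma_finite_measure set (tupR n) -> \bar R}) :
    set (tupR n.+1) -> \bar R :=
  pushforward (leb \x mu)%E (@cons_tup n).

Section instances.
Variables (n : nat) (mu : {sigma_finite_measure set (tupR n) -> \bar R}).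

(* The measure structure of [pushforward] takes a measurability proof, which
   canonical structure inference cannot supply. *)
Let lebesgue_consT_measure : {measure set (tupR n.+1) -> \bar R} :=
  measure_function_pushforward__canonical__measure_function_Measure
    (leb \x mu)%E (@measurable_cons_tup n).

HB.instance Definition _ := isMeasure.Build _ _ _ (lebesgue_consT mu)
  (measure0 lebesgue_consT_measure) (measure_ge0 lebesgue_consT_measure)
  (@measure_semi_sigma_additive _ _ _ lebesgue_consT_measure).

Lemma lebesgue_consT_sigma_finite : sigma_finite setT (lebesgue_consT mu).
Proof.
have [F [TF ndF Foo]] := (sigma_finiteP _ _).1 (@sigma_finiteT _ _ _ leb).
have [G [TG ndG Goo]] := (sigma_finiteP _ _).1 (sigma_finiteT mu).
pose uncons (x : tupR n.+1) : measurableTypeR R * tupR n :=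
  (thead x, [tuple of behead x]).
have unconsK : cancel (@cons_tup n) uncons.
  move=> [a b]; rewrite /uncons /cons_tup/=; congr pair.
  by apply/val_inj.
have mun : measurable_fun setT uncons.
  apply: measurable_fun_pair; first exact: measurable_tnth.
  exact: measurable_behead.
exists (fun k => uncons @^-1` (F k `*` G k)).
  rewrite -preimage_bigcup; apply/esym; rewrite -subTset => x _ /=.
  have [p _ Fp] : (\bigcup_i F i) (uncons x).1 by rewrite -TF.
  have [q _ Gq] : (\bigcup_i G i) (uncons x).2 by rewrite -TG.
  exists (maxn p q) => //; split.
  - by move: Fp; exact/subsetPset/ndF/leq_maxl.
  - by move: Gq; exact/subsetPset/ndG/leq_maxr.
move=> k; have [mF Fk] := Foo k; have [mG Gk] := Goo k; split.
  by rewrite -[X in measurable X]setTI; apply: mun => //; exact: measurableX.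
rewrite /lebesgue_consT /pushforward -comp_preimage.
rewrite (_ : uncons \o _ = id) ?preimage_id; last exact/funext.
by rewrite product_measure1E// lte_mul_pinfty// ge0_fin_numE.
Qed.

HB.instance Definition _ :=
  Measure_isSigmaFinite.Build _ _ _ (lebesgue_consT mu)
    lebesgue_consT_sigma_finite.

End instances.

Fixpoint lebesgue_tuple (n : nat) :
    {sigma_finite_measure set (tupR n) -> \bar R} :=
  match n with
  | 0 => \d_([tuple] : tupR 0)
  | n'.+1 => lebesgue_consT (lebesgue_tuple n')
  end.

End lebesgue_tuple.

Section spacetime.
Context {R : realType} {m : nat}.
Implicit Types (A : R * 'rV[R]_m -> 'M[R]_m) (h : R * 'rV[R]_m -> R[i]).

Definition row_of_tuple (x : m.-tuple (measurableTypeR R)) : 'rV[R]_m :=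
  \row_i tnth x i.

Definition int_Rm (F : 'rV[R]_m -> \bar R) : \bar R :=
  (\int[lebesgue_tuple m]_x F (row_of_tuple x))%E.

Definition int_slab (t2 : R) (F : R * 'rV[R]_m -> \bar R) : \bar R :=
  (\int[lebesgue_measure]_(t in `]0%R, t2[) int_Rm (fun v => F (t, v)))%E.

Definition slab (T : R) : set (R * 'rV[R]_m) := [set p | 0 < p.1 < T].

Definition ae_slab (T : R) (P : R * 'rV[R]_m -> Prop) : Prop :=
  {ae (lebesgue_measure \x lebesgue_tuple m)%E,
    forall p, slab T (p.1, row_of_tuple p.2) -> P (p.1, row_of_tuple p.2)}.

Definition e_t : R * 'rV[R]_m := (1, 0).
Definition e_v (i : 'I_m) : R * 'rV[R]_m := (0, delta_mx 0 i).

(* Derivatives of complex-valued functions are taken on the real and imaginary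
   parts. At points of non-differentiability 'D_u takes a default value; for the
   Lipschitz functions considered here these points form a null set. *)
Definition cderive h (u p : R * 'rV[R]_m) : R[i] :=
  Complex ('D_u (fun q => complex.Re (h q)) p)
          ('D_u (fun q => complex.Im (h q)) p).

Definition normc2 (z : R[i]) : R := complex.Re z ^+ 2 + complex.Im z ^+ 2.

Definition grad_v2 h p : R := \sum_(i < m) normc2 (cderive h (e_v i) p).

Definition div_v_grad_v A h p : R[i] :=
  \sum_(i < m)
    cderive (fun q => \sum_(j < m) (A q i j)%:C%C * cderive h (e_v j) q)
            (e_v i) p.

Definition smooth (f : R * 'rV[R]_m -> R) : Prop :=
  forall us : seq (R * 'rV[R]_m),
    let g := foldr (fun u k => 'D_u k) f us in
    continuous g /\ forall u p, derivable g p u.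

(* C_c^oo((0,t2) x R^m); its elements are extended by zero to R x R^m *)
Definition test_function (t2 : R) h : Prop :=
  [/\ smooth (fun p => complex.Re (h p)),
      smooth (fun p => complex.Im (h p)),
      compact (closure [set p | h p != 0]) &
      closure [set p | h p != 0] `<=` slab t2].

Definition elliptic_lipschitz (lam T : R) A : Prop :=
  [/\ forall p, slab T p -> forall i j, A p i j = A p j i,
      forall i j, [lipschitz (A p i j : R) | p in slab T],
      forall p, slab T p -> forall xi : 'rV[R]_m,
        lam^-1 * (\sum_(i < m) xi 0 i ^+ 2)
          <= \sum_(i < m) \sum_(j < m) A p i j * xi 0 i * xi 0 j
          <= lam * (\sum_(i < m) xi 0 i ^+ 2) &
      forall i j, ae_slab T (fun p =>
        `|'D_(e_t) (fun q => A q i j : R) p|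
          + Num.sqrt (\sum_(k < m) 'D_(e_v k) (fun q => A q i j : R) p ^+ 2)
        <= lam)].

End spacetime.

Definition expmx {R : realType} {n : nat} (M : 'M[R]_n) : 'M[R]_n :=
  limn (series (fun k => k`!%:R^-1 *: M ^+ k)).

Definition kalman {R : realType} {m n : nat}
    (B1 : 'M[R]_(n, m)) (B2 : 'M[R]_n) : Prop :=
  \rank (\mxrow_(k < n) (B2 ^+ k *m B1)) = n.

Definition frequency {R : realType} {m n : nat}
    (B1 : 'M[R]_(n, m)) (B2 : 'M[R]_n) (rho : 'cV[R]_n) (t : R) : 'cV[R]_m :=
  B1^T *m expmx (- t *: B2^T) *m rho.

Definition Ptilde {R : realType} {m n : nat}
    (A : R * 'rV[R]_m -> 'M[R]_m) (B1 : 'M[R]_(n, m)) (B2 : 'M[R]_n)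
    (rho : 'cV[R]_n) (h : R * 'rV[R]_m -> R[i]) (p : R * 'rV[R]_m) : R[i] :=
  cderive h e_t p
  + 'i%C * (\sum_(i < m) frequency B1 B2 rho p.1 i 0 * p.2 0 i)%:C%C * h p
  + div_v_grad_v A h p
  - (2^-1 * \tr B2)%:C%C * h p.

(* Main.v *)
Require Import Defs.
From HB Require Import structures.
From mathcomp Require Import all_boot all_order all_algebra.
From mathcomp Require Import complex.
From mathcomp Require Import all_classical all_reals all_analysis.
From mathcomp Require Import measurable_realfun ring lra.

Set Implicit Arguments.
Unset Strict Implicit.
Unset Printing Implicit Defensive.

Import Order.TTheory GRing.Theory Num.Theory.
Import numFieldNormedType.Exports.

Local Open Scope classical_set_scope.
Local Open Scope ring_scope.

(** Write s = t + b, set g = s^-alpha h and split the conjugated operator into its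
    antisymmetric part X = d_t + i (phi . v) and its symmetric part
    Y = div (A grad) + alpha/s - tr B2 / 2. Then s |(X + Y) g|^2 >= 2 s Re (X g . Y g),
    and integrating by parts the right-hand side gives the coercive commutator term
    [d_t, s div (A grad)], which controls |grad g|^2, up to the derivative of A in
    time and the commutator of i (phi . v) with A; both are absorbed by smallness of
    c0 and eps0. The weighted L^2 norm of g is recovered by testing the equation
    against g itself. The rank condition plays no role.

    All integrations by parts are performed at once: almost everywhere, the
    difference of the two sides dominates a sum of directional derivatives of
    Lipschitz fluxes with compact support, and such derivatives have zero integral,
    because the measure is invariant under translations along the direction. The
    coefficients being only Lipschitz, this needs Rademacher's theorem on lines. *)

(** * Differentiability of Lipschitz functions of one variable *)

(** The commutator alone cannot give the zero-order term: 2 s Re (d_t g . (alpha/s) g) = alpha d_t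
    |g|^2 is an exact derivative. What it gives is A grad g . grad g with a coefficient independent
    of alpha, coming from d_t acting on the factor s. Testing against g with the small weight mu =
    1/(8 lam^2) then produces 2 mu (alpha/s) |g|^2 at the price 2 mu A grad g . grad g, which the
    commutator pays. The conjugation is not carried out: everything is written for h with the
    weights s^(-2 alpha) and s^(1 - 2 alpha). The drift phi . v is unbounded in v and is handled
    only as a measurable function of t. It enters the fluxes differentiated in v only, and the
    symmetry of A removes every term where phi . v itself multiplies gradients, so that phi alone
    remains. Two points shape the integration. A is controlled on the slab only, so it always
    appears multiplied by a function supported there. The right-hand integrand contains derivatives
    with default values and is not shown to be measurable, so it is only bounded from below,
    pointwise, by a measurable function. *)

Section rademacher_1d.
Context {R : realType}.
Local Notation leb := (@lebesgue_measure R).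

Lemma lebesgue_stieltjes_measure_oc (F : cumulative R R) (a b : R) : a <= b ->
  lebesgue_stieltjes_measure F `]a, b]%classic = (F b - F a)%:E.
Proof.
move=> ab; rewrite /lebesgue_stieltjes_measure /measure_extension/=.
by rewrite measurable_mu_extE/= ?wlength_itv_bnd//; exact: is_ocitv.
Qed.

(* The Stieltjes measures of F and id - F add up to Lebesgue measure, so dF has a
   Radon-Nikodym density, of which F is a primitive. *)
Lemma ae_derivable_cumulative (F G : cumulative R R) :
  (forall x, F x + G x = x) -> {ae leb, forall x, derivable F x 1}.
Proof.
move=> FG.
pose m : {measure set (measurableTypeR R) -> \bar R} :=
  measure_add (lebesgue_stieltjes_measure F) (lebesgue_stieltjes_measure G).
have mE A : m A =
    (lebesgue_stieltjes_measure F A + lebesgue_stieltjes_measure G A)%E.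
  exact: measure_addE.
have lebE A : measurable A -> leb A =
    (lebesgue_stieltjes_measure F A + lebesgue_stieltjes_measure G A)%E.
  move=> mA; rewrite -mE.
  apply: lebesgue_measure_unique => // _ [[a b] _ <-] /=.
  rewrite mE.
  have [ab|ba] := leP a b; last first.
    by rewrite set_itv_ge ?bnd_simp -?leNgt ?ltW// !measure0 adde0.
  have -> : leb `]a, b]%classic = (b - a)%:E.
    exact: (lebesgue_stieltjes_measure_oc idfun).
  rewrite !lebesgue_stieltjes_measure_oc// -EFinD; congr (_%:E).
  by have := FG a; have := FG b; lra.
(* Restricting dF to a bounded interval makes it finite, so that its density is integrable on the
   whole line; countably many intervals exhaust the line. *)
pose D (r : nat) : set (measurableTypeR R) := `]- r%:R, r%:R]%classic.
have mD r : measurable (D r) by exact: measurable_itv.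
have rr (r : nat) : - (r%:R : R) <= r%:R by rewrite (@le_trans _ _ 0)// oppr_le0.
have fD r : (lebesgue_stieltjes_measure F (D r) < +oo)%E.
  by rewrite /D lebesgue_stieltjes_measure_oc// ltry.
suff H (r : nat) : {ae leb, forall x, `|x| < r%:R -> derivable F x 1}.
  have := ae_foralln (fun r => H r).
  apply: filterS => x /(_ (Num.truncn `|x|).+1); apply.
  exact: truncnS_gt.
pose nu := mfrestr (mD r) (fD r).
have nuE A : nu A = lebesgue_stieltjes_measure F (A `&` D r) by [].
(* Absolute continuity: dF <= dF + dG, which is Lebesgue measure. *)
have nuleb : nu `<< leb.
  apply/null_content_dominatesP => A mA A0; apply/eqP.
  rewrite nuE -measure_le0.
  have mAD : measurable (A `&` D r) by exact: measurableI.
  have : (leb (A `&` D r) <= 0)%E.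
    by rewrite -A0 le_measure ?inE//; exact: subIsetl.
  by apply: le_trans; rewrite lebE// leeDl.
have [w [w0 wfin wint nuw]] := radon_nikodym_sigma_finite nuleb.
pose f (x : R) : R := fine (w x).
pose Fi (y : R) : R := (\int[leb]_(t in [set` `]-oo, y]]) f t)%R.
have fE : EFin \o f = w by apply/funext => x /=; rewrite /f fineK.
have fint y : leb.-integrable `]-oo, y]%classic (EFin \o f).
  by rewrite fE; apply: integrableS wint => //; exact: measurable_itv.
have floc : locally_integrable [set: R] f.
  by apply: open_integrable_locally; [exact: openT|rewrite fE].
have [N [mN N0 NP]] := FTC1Ny fint floc; exists N; split => // x ndF.
apply: NP => /= -[dF _]; apply: ndF => xr.
have near_eq : {near (x : R), (cst (F (- r%:R)) + Fi) =1 F}.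
  have xD : x \in `]- r%:R, r%:R[ by move: xr; rewrite ltr_norml in_itv.
  near=> y.
  have yD : y \in `]- r%:R, r%:R[ by near: y; exact: near_in_itvoo.
  move: yD; rewrite in_itv/= => /andP[ry yr].
  have nuy : nu `]-oo, y]%classic = (F y - F (- r%:R))%:E.
    rewrite nuE; have -> : `]-oo, y]%classic `&` D r = `]- r%:R, y]%classic.
      apply/seteqP; split => z /=; rewrite !in_itv/=.
        by move=> [zy /andP[rz _]]; apply/andP.
      move=> /andP[rz zy]; split => //; apply/andP; split => //.
      by apply: le_trans zy _; exact: ltW.
    by rewrite lebesgue_stieltjes_measure_oc// ltW.
  rewrite fctE /Fi /Rintegral; have -> : (fun x0 => (f x0)%:E) = w by exact: fE.
  have -> : (\int[leb]_(t in `]-oo, y]) w t = (F y - F (- r%:R))%:E)%E.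
    by rewrite -nuy; apply/esym/nuw; exact: measurable_itv.
  by rewrite /= addrC subrK.
apply: near_eq_derivable near_eq _.
by apply: derivableD; [exact: derivable_cst|exact: dF].
Unshelve. all: by end_near. Qed.

(** The functions x/2 + f/(2L) and x/2 - f/(2L) are nondecreasing, since f/(2L) has slope at most
    1/2; they are continuous and add up to the identity. Where the first is derivable, so is f.
    Taking [L] at least 1 makes the division legitimate. *)
Lemma lipschitz_ae_derivable (f : R -> R) (K : R) :
  (forall x y, `|f x - f y| <= K * `|x - y|) ->
  {ae leb, forall x, derivable f x 1}.
Proof.
move=> lf.
pose L := Num.max K 1.
have L0 : 0 < L by rewrite /L lt_max ltr01 orbT.
have lfL x y : `|f x - f y| <= L * `|x - y|.
  by apply: le_trans (lf x y) _; rewrite ler_wpM2r// le_max lexx.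
have cf : continuous f.
  move=> x; apply/cvgrPdist_le => e e0; near=> y.
  rewrite (le_trans (lfL _ _))// mulrC -ler_pdivlMr//.
  by near: y; apply: cvgr_dist_le; [exact: cvg_id|rewrite divr_gt0].
pose F0 (s : R) x := x / 2 + s * (f x / (2 * L)).
have ndF s : `|s| <= 1 -> nondecreasing (F0 s).
  move=> s1 x y xy; rewrite /F0 -subr_ge0.
  have -> : y / 2 + s * (f y / (2 * L)) - (x / 2 + s * (f x / (2 * L))) =
            ((y - x) - (s * (f x - f y) / L)) / 2 by field; lra.
  rewrite divr_ge0// subr_ge0 ler_pdivrMr//.
  rewrite (le_trans (ler_norm _))// normrM (le_trans (ler_piMl _ s1))//.
  by rewrite (le_trans (lfL _ _))// distrC ger0_norm ?subr_ge0// mulrC.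
have rcF s : right_continuous (F0 s).
  apply: right_continuousW => x; apply: cvgD; first by apply: cvgMl; exact: cvg_id.
  by apply: cvgMr; apply: cvgMl; exact: cf.
have s1 : `|1 : R| <= 1 by rewrite normr1.
have s2 : `|-1 : R| <= 1 by rewrite normrN1.
pose cF := isCumulative.Build R _ R (F0 1) (ndF _ s1) (rcF 1).
pose cG := isCumulative.Build R _ R (F0 (-1)) (ndF _ s2) (rcF (-1)).
have [F [G [FG FE]]] : exists F G : cumulative R R,
    (forall x, F x + G x = x) /\ forall x, F x = F0 1 x.
  pose F : cumulative R R := HB.pack (F0 1) cF.
  pose G : cumulative R R := HB.pack (F0 (-1)) cG.
  exists F, G.
  by split => // x; rewrite /= /F0; lra.
have [N [mN N0 NP]] := ae_derivable_cumulative FG.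
exists N; split; [exact: mN|exact: N0|] => x ndf.
apply: NP => dF; apply: ndf; move: dF => /= dF.
have fE (a c : R) : a = (2 * L) * (c / 2 + 1 * (a / (2 * L)) - 2^-1 * c).
  by field; rewrite gt_eqF.
have -> : f = (2 * L) \*: ((F : R -> R) - (2^-1 : R) \*: id).
  by apply/funext => y /=; rewrite /GRing.scale/= fctE FE; exact: fE.
apply: derivableZ; apply: derivableB; first exact: dF.
by apply: derivableZ; exact: derivable_id.
Unshelve. all: by end_near. Qed.

End rademacher_1d.

(** * Translation invariance of the product measure *)

Section translation.
Context {R : realType}.
Local Notation leb := (@lebesgue_measure R).
Local Notation tupR n := (n.-tuple (measurableTypeR R)).

Lemma measurable_preimage d1 d2 (T1 : measurableType d1) (T2 : measurableType d2)
    (f : T1 -> T2) (A : set T2) :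
  measurable_fun setT f -> measurable A -> measurable (f @^-1` A).
Proof. by move=> mf mA; have := mf measurableT _ mA; rewrite setTI. Qed.

Definition preserves d (T : measurableType d) (mu : set T -> \bar R)
    (phi : T -> T) :=
  measurable_fun setT phi /\
  forall A, measurable A -> mu (phi @^-1` A) = mu A.

Lemma preserves_lebesgue_shift (c : R) :
  preserves leb (fun x : measurableTypeR R => c + x).
Proof.
have mc : measurable_fun setT (fun x : measurableTypeR R => (c + x : measurableTypeR R)).
  by apply: measurable_funD => //; exact: measurable_cst.
split => // A mA.
pose nu : {measure set (measurableTypeR R) -> \bar R} :=
  measure_function_pushforward__canonical__measure_function_Measure leb mc.
rewrite -[LHS]/(nu A); apply/esym; apply: lebesgue_measure_unique => //.
move=> _ [[a b] _ <-] /=; rewrite /pushforward.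
have -> : (fun x : measurableTypeR R => c + x) @^-1` `]a, b]%classic =
    `](a - c), (b - c)]%classic.
  by apply/seteqP; split => x /=; rewrite !in_itv/= ltrBlDl lerBrDl.
by rewrite !lebesgue_measure_itv/= !lte_fin ltrD2r; case: ifP => // _; congr (_%:E); lra.
Qed.

(** The image of the product measure agrees with it on rectangles, which determine it. *)
Lemma preserves_prod d1 d2 (T1 : measurableType d1) (T2 : measurableType d2)
    (m1 : {sigma_finite_measure set T1 -> \bar R})
    (m2 : {sigma_finite_measure set T2 -> \bar R}) (p1 : T1 -> T1) (p2 : T2 -> T2) :
  preserves m1 p1 -> preserves m2 p2 ->
  preserves (m1 \x m2)%E (fun x => (p1 x.1, p2 x.2)).
Proof.
move=> [mp1 p1E] [mp2 p2E].
have mp : measurable_fun setT (fun x : T1 * T2 => (p1 x.1, p2 x.2)).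
  by apply: measurable_fun_pair; apply: measurableT_comp.
split => // A mA.
pose nu : {measure set (T1 * T2) -> \bar R} :=
  measure_function_pushforward__canonical__measure_function_Measure (m1 \x m2)%E mp.
rewrite -[LHS]/(nu A); apply/esym; apply: product_measure_unique => // B C mB mC.
rewrite /nu/= /pushforward.
have -> : (fun x : T1 * T2 => (p1 x.1, p2 x.2)) @^-1` (B `*` C) =
    (p1 @^-1` B) `*` (p2 @^-1` C) by [].
have mB1 := measurable_preimage mp1 mB.
have mC2 := measurable_preimage mp2 mC.
by rewrite -(p1E _ mB) -(p2E _ mC); exact: product_measure1E.
Qed.

Definition add_tup n (c x : tupR n) : tupR n :=
  [tuple (tnth c i + tnth x i : measurableTypeR R) | i < n].

(** By induction on the dimension: through [cons_tup], a shift is the product of a shift of the line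
    and a shift of the remaining coordinates. *)
Lemma preserves_add_tup n (c : tupR n) :
  preserves (lebesgue_tuple n) (add_tup c).
Proof.
elim: n c => [|n IH] c.
  have -> : add_tup c = id by apply/funext => x; rewrite (tuple0 x) tuple0.
  by split; [exact: measurable_id|].
have mc : measurable_fun setT (add_tup c).
  apply/measurable_fun_tnthP => i.
  rewrite (_ : _ \o _ = (fun x => tnth c i + tnth x i)); last first.
    by apply/funext => x; rewrite /= tnth_mktuple.
  by apply: measurable_funD; [exact: measurable_cst|exact: measurable_tnth].
split => // A mA.
rewrite -[LHS]/((leb \x lebesgue_tuple n)%E (@cons_tup _ n @^-1` (add_tup c @^-1` A))).
rewrite -[RHS]/((leb \x lebesgue_tuple n)%E (@cons_tup _ n @^-1` A)).
have [_ pE] := preserves_prod (preserves_lebesgue_shift (thead c)) (IH [tuple of behead c]).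
rewrite -[RHS]pE; last first.
  exact: measurable_preimage (@measurable_cons_tup _ n) mA.
congr (_ _); apply: eq_set => -[x y] /=; congr (A _).
apply: eq_from_tnth => i; rewrite tnth_mktuple /cons_tup.
case: (unliftP ord0 i) => [j ->|->].
  by rewrite !tnthS tnth_mktuple /=; congr (_ + _); rewrite [in LHS](tuple_eta c) tnthS.
by rewrite !tnth0 [in LHS](tuple_eta c) tnth0.
Qed.

Definition box n (r : R) : set (tupR n) := [set x | forall i, `|tnth x i| <= r].

Lemma measurable_box n (r : R) : measurable (@box n r).
Proof.
have -> : @box n r = \bigcap_(i in [set: 'I_n])
    ((fun x : tupR n => tnth x i) @^-1` (`[- r, r]%classic : set (measurableTypeR R))).
  apply/seteqP; split => x /= H i; first by move=> _; rewrite /= in_itv/= -ler_norml.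
  by have := H i I; rewrite /= in_itv/= -ler_norml.
apply: fin_bigcap_measurable => // i _.
apply: measurable_preimage; [exact: measurable_tnth|exact: measurable_itv].
Qed.

Lemma lebesgue_tuple_box_lty n (r : R) : (lebesgue_tuple n (@box n r) < +oo)%E.
Proof.
elim: n => [|n IH].
  by rewrite /= /dirac indicE ltry.
rewrite -[ltLHS]/((leb \x lebesgue_tuple n)%E (@cons_tup _ n @^-1` (@box n.+1 r))).
have -> : @cons_tup R n @^-1` (@box n.+1 r) = `[- r, r]%classic `*` (@box n r).
  apply/seteqP; split => -[x y] /=.
    move=> H; split; first by have := H ord0; rewrite tnth0 in_itv/= -ler_norml.
    by move=> i; have := H (lift ord0 i); rewrite tnthS.
  rewrite in_itv/= -ler_norml => -[xr yr] i.
  by case: (unliftP ord0 i) => [j ->|->]; rewrite ?tnthS ?tnth0.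
have mI : measurable (`[- r, r]%classic : set (measurableTypeR R)).
  exact: measurable_itv.
rewrite (product_measure1E leb (lebesgue_tuple n) mI (@measurable_box n r)).
apply: lte_mul_pinfty; [exact: measure_ge0| |exact: IH].
rewrite ge0_fin_numE; last exact: measure_ge0.
have fI : (leb [set x : R | x \in `[(- r)%R, r]] < +oo)%E.
  by rewrite lebesgue_measure_itv/=; case: ifP => // _; rewrite ltry.
exact: fI.
Qed.

End translation.

(** * Derivatives along measure preserving flows *)

Section integrable_support.
Context d (X : measurableType d) (R : realType)
  (mu : {measure set X -> \bar R}).

Lemma integrable_bounded_support (f : X -> R) (B : R) (D : set X) :
  measurable_fun setT f -> (forall x, `|f x| <= B) -> measurable D ->
  (mu D < +oo)%E -> (forall x, ~ D x -> f x = 0) ->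
  mu.-integrable setT (EFin \o f).
Proof.
move=> mf fB mD muD f0.
have iB : mu.-integrable setT (fun x => (B * \1_D x)%:E).
  have i1 : mu.-integrable setT (EFin \o \1_D).
    apply/integrableP; split; first exact/measurable_EFinP/measurable_indic.
    rewrite (eq_integral (fun x => (\1_D x)%:E)); last first.
      by move=> x _ /=; rewrite ger0_norm.
    by rewrite integral_indic// setIT.
  exact: (integrableZl measurableT B i1).
apply: le_integrable iB => //; first exact/measurable_EFinP.
move=> x _ /=; rewrite lee_fin.
have B0 : 0 <= B by apply: le_trans (fB x).
rewrite (ger0_norm (mulr_ge0 _ _))// indicE.
have [xD|xD] := boolP (x \in D); first by rewrite mulr1.
by rewrite f0 ?normr0 ?mulr0//; move/negP: xD; apply: contra_not; rewrite inE.
Qed.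
End integrable_support.

Section flow.
Context d (X : measurableType d) (R : realType)
  (mu : {sigma_finite_measure set X -> \bar R}).
Local Notation leb := (@lebesgue_measure R).

(** Abstracts translation along a fixed direction. Joint measurability in time and point is there
    for Fubini's theorem. *)
Record measure_flow (T : R -> X -> X) : Prop := MeasureFlow {
  flow0 : forall x, T 0 x = x ;
  flowD : forall s r x, T (s + r) x = T s (T r x) ;
  measurable_flow :
    measurable_fun setT (fun z : measurableTypeR R * X => T z.1 z.2) ;
  flow_preserves : forall s, preserves mu (T s) }.

Variables (T : R -> X -> X) (flowT : measure_flow T).
Variables (F : X -> R) (K : R).
Hypothesis mF : measurable_fun setT F.
Hypothesis lipF : forall s x, `|F (T s x) - F x| <= K * `|s|.

Let orb x s := F (T s x).

Let orb_lip x s r : `|orb x s - orb x r| <= K * `|s - r|.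
Proof.
by rewrite /orb -[s in T s x](subrK r) (flowD flowT); exact: lipF.
Qed.

Let orb_cont x : continuous (orb x).
Proof.
move=> s; apply/cvgrPdist_le => e e0; near=> r.
apply: le_trans (orb_lip x s r) _.
have K1 : K <= `|K| + 1 by rewrite (le_trans (ler_norm K))// lerDl.
rewrite (le_trans (ler_wpM2r _ K1))// mulrC -ler_pdivlMr ?ltr_wpDl//.
near: r; apply: cvgr_dist_le; first exact: cvg_id.
by rewrite divr_gt0// ltr_wpDl.
Unshelve. all: by end_near. Qed.

Let quo x h := h^-1 * (orb x h - F x).

Let quoE x : (fun h : R => h^-1 *: ((orb x \o shift 0) (h *: 1) - orb x 0)) = quo x.
Proof.
apply/funext => h; rewrite /quo /orb (flow0 flowT) /= addr0.
by rewrite /GRing.scale /= mulr1.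
Qed.

Let close (k n : nat) x (p : rat * rat) :=
  0 < `|ratr p.1 : R| < n.+1%:R^-1 -> 0 < `|ratr p.2 : R| < n.+1%:R^-1 ->
  `|quo x (ratr p.1) - quo x (ratr p.2)| <= k.+1%:R^-1.

(** The Cauchy criterion at 0 for the difference quotient along the orbit, tested on rational
    increments only. Pairs of rationals are enumerated by [unpickle], so the set is built by
    countable operations and is measurable. *)
Let good : set X := \bigcap_(k : nat) \bigcup_(n : nat) \bigcap_(j : nat)
  [set x | if @unpickle (rat * rat)%type j is Some p then close k n x p else True].

Let measurable_quo h : measurable_fun setT (fun x => quo x h).
Proof.
apply: measurable_funM => //; apply: measurable_funB => //.
by apply: measurableT_comp => //; have [] := flow_preserves flowT h.
Qed.

Let measurable_good : measurable good.
Proof.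
apply: bigcap_measurable => // k _; apply: bigcup_measurable => n _.
apply: bigcap_measurable => // j _.
case: (unpickle j) => [p|]; last exact: measurableT.
rewrite /close.
have [p1|p1] := boolP (0 < `|ratr p.1 : R| < n.+1%:R^-1); last first.
  by rewrite (_ : [set _ | _] = setT)//; apply/seteqP; split.
have [p2|p2] := boolP (0 < `|ratr p.2 : R| < n.+1%:R^-1); last first.
  by rewrite (_ : [set _ | _] = setT)//; apply/seteqP; split.
rewrite (_ : [set _ | _] =
    (fun x => `|quo x (ratr p.1) - quo x (ratr p.2)|) @^-1` `]-oo, k.+1%:R^-1]%classic).
  apply: measurable_preimage; last exact: measurable_itv.
  by apply: measurableT_comp => //; apply: measurable_funB; exact: measurable_quo.
by apply/seteqP; split => x /=; rewrite in_itv/= => H; [exact: H|move=> _ _].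
Qed.

(** Rational increments suffice because the quotient is continuous in the increment away from 0: a
    violation at a real increment persists at a nearby rational one. *)
Let goodP x : good x <-> derivable (orb x) 0 1.
Proof.
split.
  move=> gx; rewrite /derivable quoE.
  apply/cauchy_cvgP; apply: cauchy_exP => e e0.
  pose k := Num.truncn e^-1.
  have ke : k.+1%:R^-1 < e.
    by rewrite -[ltRHS]invrK ltf_pV2 ?posrE ?invr_gt0//; exact: truncnS_gt.
  have [n _ gn] := gx k I.
  have n0 : (0 : R) < n.+1%:R^-1 by rewrite invr_gt0.
  have [q] := rat_in_itvoo n0; rewrite in_itv/= => /andP[q0 qn].
  exists (quo x (ratr q)).
  have qq : 0 < `|ratr q : R| < n.+1%:R^-1 by rewrite gtr0_norm// q0 qn.
  exists n.+1%:R^-1 => //= h; rewrite /ball_/= sub0r normrN => hn h0.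
  rewrite /ball/=; apply: le_lt_trans ke.
  rewrite leNgt; apply/negP => abs.
  have cq : quo x r @[r --> h] --> quo x h.
    apply: cvgM; first by apply: cvgV => //; exact: cvg_id.
    by apply: cvgB; [exact: orb_cont|exact: cvg_cst].
  have c1 : `|quo x (ratr q) - quo x r| @[r --> h] --> `|quo x (ratr q) - quo x h|.
    by apply: cvg_norm; apply: cvgB => //; exact: cvg_cst.
  have c2 : `|r| @[r --> h] --> `|h| by apply: cvg_norm; exact: cvg_id.
  have c3 : r @[r --> h] --> h by exact: cvg_id.
  have : \forall r \near h, [/\ k.+1%:R^-1 < `|quo x (ratr q) - quo x r|,
      `|r| < n.+1%:R^-1 & r != 0].
    near=> r; split.
    - by near: r; exact: (cvgr_gt _ c1).
    - by near: r; exact: (cvgr_lt _ c2).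
    - by near: r; apply: (cvgr_neq0 h c3).
  move=> -[del /= del0 H].
  have hd : h < h + del by rewrite ltrDl.
  have [r] := rat_in_itvoo hd; rewrite in_itv/= => /andP[hr rd].
  have [|H1 H2 H3] := H (ratr r).
    by rewrite /ball_/= ltr0_norm ?subr_lt0// opprB ltrBlDl.
  have : close k n x (q, r).
    by have := gn (pickle (q, r)) I; rewrite /mkset pickleK.
  rewrite /close => /(_ qq).
  rewrite normr_gt0 H3 H2 => /(_ erefl).
  by rewrite leNgt H1.
rewrite /derivable quoE => /cvg_ex[l /= ql] k _.
have e0 : (0 : R) < k.+1%:R^-1 / 2 by rewrite divr_gt0 ?invr_gt0.
move/cvgrPdist_le: ql => /(_ _ e0) [del /= del0 H].
pose n := Num.truncn (del^-1).
have nd : (n.+1%:R^-1 : R) < del.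
  by rewrite -[ltRHS]invrK ltf_pV2 ?posrE ?invr_gt0//; exact: truncnS_gt.
exists n => // j _ /=; case: (unpickle j) => // p.
have Hr (r : rat) : 0 < `|ratr r : R| < n.+1%:R^-1 ->
    `|l - quo x (ratr r)| <= k.+1%:R^-1 / 2.
  move=> /andP[r0 rn]; apply: H.
    by rewrite /ball_/= sub0r normrN (lt_trans rn).
  by rewrite -normr_gt0.
move=> /Hr H1 /Hr H2; rewrite [leRHS]splitr.
have -> : quo x (ratr p.1) - quo x (ratr p.2) =
    (l - quo x (ratr p.2)) - (l - quo x (ratr p.1)) by ring.
by rewrite (le_trans (ler_normB _ _))// lerD.
Unshelve. all: by end_near. Qed.

(** Fubini for the set of pairs (s, x) such that T s x is bad. For fixed x the bad times are null,
    the orbit function being Lipschitz on the line; for fixed s the bad points have the measure of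
    the bad set, by invariance. A constant whose integral over the whole line is 0 must vanish. *)
Lemma flow_ae_derivable :
  exists2 N, measurable N /\ mu N = 0%E &
    forall x, ~ N x -> derivable (fun s => F (T s x)) 0 1.
Proof.
exists (~` good); last by move=> x /contrapT/goodP.
have mN : measurable (~` good) by exact: measurableC.
split => //.
pose B : set (measurableTypeR R * X) := (fun z => T z.1 z.2) @^-1` (~` good).
have mB : measurable B by apply: measurable_preimage mN; exact: measurable_flow.
pose f (z : measurableTypeR R * X) : \bar R := (\1_B z)%:E.
have mf : measurable_fun setT f.
  by apply/measurable_EFinP; exact: measurable_indic.
have f0 z : (0 <= f z)%E by rewrite lee_fin.
have := @fubini_tonelli _ _ _ _ _ leb mu f mf f0.
have -> : (fun s : measurableTypeR R => \int[mu]_x f (s, x))%E = cst (mu (~` good)).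
  apply/funext => s /=.
  have [mTs TsE] := flow_preserves flowT s.
  rewrite -(TsE _ mN) /f.
  rewrite (eq_integral (fun x => (\1_(T s @^-1` (~` good)) x)%:E))//.
  rewrite integral_indic// ?setIT//.
  exact: measurable_preimage mN.
have -> : (fun x => \int[leb]_s f (s, x))%E = cst 0%E.
  apply/funext => x /=; rewrite /f.
  rewrite (eq_integral (fun s : measurableTypeR R =>
    (\1_((fun s : measurableTypeR R => T s x) @^-1` (~` good)) s)%:E))//.
  have mTx : measurable_fun setT (fun s : measurableTypeR R => T s x).
    have mp : measurable_fun setT (fun s : measurableTypeR R => (s, x)).
      exact: measurable_fun_pair.
    exact: (measurableT_comp (measurable_flow flowT) mp).
  have mBx : measurable ((fun s : measurableTypeR R => T s x) @^-1` (~` good)).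
    exact: measurable_preimage mN.
  rewrite integral_indic// setIT.
  have [N [mN' N0 NP]] := lipschitz_ae_derivable (orb_lip x).
  apply: (subset_measure0 mBx mN' _ N0) => s Ts; apply: NP => ds; apply: Ts.
  apply/goodP; rewrite /derivable quoE.
  suff <- : (fun h : R => h^-1 *: ((orb x \o shift (s : R)) (h *: 1) - orb x s)) =
      quo (T s x) by exact: ds.
  apply/funext => h; rewrite /quo /orb /= -(flowD flowT).
  by rewrite /GRing.scale /= mulr1.
have lT : leb [set x : R | x \in `]-oo, +oo[] = +oo%E.
  by rewrite lebesgue_measure_itv.
rewrite integral_cst// integral0.
move/eqP; rewrite mule_eq0 => /orP[/eqP//|/eqP l0].
have : (+oo : \bar R)%E = 0%E.
  by rewrite -lT -l0; congr (leb _); apply/seteqP; split.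
by [].
Qed.

Lemma integral_flow s (G : X -> R) : measurable_fun setT G ->
  mu.-integrable setT (EFin \o G) ->
  mu.-integrable setT (EFin \o (G \o T s)) /\
  (\int[mu]_x (G (T s x))%:E = \int[mu]_x (G x)%:E)%E.
Proof.
move=> mG iG; have [mTs TsE] := flow_preserves flowT s.
pose nu : {measure set X -> \bar R} :=
  measure_function_pushforward__canonical__measure_function_Measure mu mTs.
have nuE (f : X -> \bar R) : (\int[nu]_x f x = \int[mu]_x f x)%E.
  by apply: eq_measure_integral => A mA _; exact: TsE.
have mGE : measurable_fun setT (EFin \o G) by exact/measurable_EFinP.
have iGT : mu.-integrable setT (EFin \o (G \o T s)).
  apply/integrableP; split; first by apply/measurable_EFinP; exact: measurableT_comp.
  move/integrableP : iG => [_]; rewrite -nuE.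
  rewrite ge0_integral_pushforward//.
  by apply: measurableT_comp.
split => //.
by rewrite -[RHS]nuE integral_pushforward.
Qed.

(** Each difference quotient with step 1/(n+1) has zero integral by invariance, is bounded by K and
    vanishes off D; dominated convergence passes this to the derivative. D contains a margin around
    the support, so that steps of length at most 1 starting outside D meet only zeros of F. *)
Lemma flow_integral_derive (B : R) (D : set X) :
  (forall x, `|F x| <= B) -> measurable D -> (mu D < +oo)%E ->
  (forall x s, ~ D x -> `|s| <= 1 -> F (T s x) = 0) ->
  exists N dF, [/\ measurable N /\ mu N = 0%E, measurable_fun setT dF,
    mu.-integrable setT (EFin \o dF), (\int[mu]_x (dF x)%:E = 0)%E &
    forall x, ~ N x -> is_derive (0 : R) 1 (fun s => F (T s x)) (dF x)].
Proof.
move=> FB mD muD F0.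
have [N [mN N0] dN] := flow_ae_derivable.
pose g (n : nat) x := quo x n.+1%:R^-1.
have mg n : measurable_fun setT (g n) by exact: measurable_quo.
pose gN n x := \1_(~` N) x * g n x.
have mNC : measurable (~` N) by exact: measurableC.
have mgN n : measurable_fun setT (gN n).
  by apply: measurable_funM => //; exact: measurable_indic.
(* The value 0 on the exceptional set makes [dF] an everywhere limit of measurable functions. *)
pose dF x := if x \in N then 0 else 'D_1 (orb x) 0.
have inN x : x \in N \/ ~ N x.
  by have [xN|xN] := pselect (N x); [left; rewrite inE|right].
have dFcvg x : gN ^~ x @ \oo --> dF x.
  have [xN|xN] := inN x.
    rewrite /dF xN; apply: cvg_near_cst; near=> n.
    by rewrite /gN indicE in_setC xN mul0r.
  rewrite /dF /gN memNset// indicE in_setC memNset//=.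
  under eq_fun do rewrite mul1r.
  have := dN x xN; rewrite /derivable quoE => dx.
  rewrite /derive quoE.
  have inv0 : (fun n : nat => n.+1%:R^-1 : R) n @[n --> \oo] --> (0 : R)^'.
    move=> A [e /= e0 eA]; have := @cvg_harmonic R.
    move/cvgrPdist_lt => /(_ e e0); apply: filterS => n; rewrite sub0r normrN => nA.
    apply: eA; first by rewrite /ball_/= sub0r normrN.
    by rewrite gt_eqF// invr_gt0.
  exact: cvg_comp inv0 dx.
have mdF : measurable_fun setT dF.
  by apply: (measurable_fun_cvg mgN) => x _; exact: dFcvg.
have gb n x : `|g n x| <= K.
  rewrite /g /quo normrM ger0_norm// ler_pdivrMl// mulrC.
  by apply: le_trans (lipF _ _) _; rewrite ger0_norm.
have gD n x : ~ D x -> g n x = 0.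
  move=> Dx; rewrite /g /quo /orb F0//; last first.
    by rewrite ger0_norm// invf_le1// ler1n.
  by rewrite -[x in F x](flow0 flowT) F0 ?normr0// subrr mulr0.
have gNb n x : `|gN n x| <= K * \1_D x.
  rewrite /gN normrM !indicE.
  have [xD|xD] := boolP (x \in D); last first.
    rewrite gD ?normr0 ?mulr0//.
    by move/negP: xD; apply: contra_not; rewrite inE.
  by rewrite mulr1 -[leRHS]mul1r ler_pM// ?gb// ; case: (x \in _); rewrite /= ?normr0 ?normr1.
have iKD : mu.-integrable setT (EFin \o (fun x => K * \1_D x)).
  apply: (@integrable_bounded_support _ _ _ _ _ `|K| D) => //.
  - by apply: measurable_funM => //; exact: measurable_indic.
  - move=> x; rewrite normrM ler_piMr// indicE.
    by case: (x \in _); rewrite /= ?normr0 ?normr1.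
  - by move=> x xD; rewrite indicE memNset ?mulr0.
have idF : mu.-integrable setT (EFin \o dF).
  apply: le_integrable iKD => //; first exact/measurable_EFinP.
  move=> x _ /=; rewrite lee_fin.
  apply: (@le_trans _ _ (K * \1_D x)); last exact: ler_norm.
  apply: (cvgr_to_le (cvg_norm (dFcvg x))).
  by near=> n; exact: gNb.
have iF : mu.-integrable setT (EFin \o F).
  apply: (integrable_bounded_support mF FB mD muD) => x Dx.
  by rewrite -[x in F x](flow0 flowT) F0// normr0.
have int0 n : (\int[mu]_x (gN n x)%:E = 0)%E.
  have [iFT eFT] := integral_flow n.+1%:R^-1 mF iF.
  transitivity (\int[mu]_x (g n x)%:E)%E.
    apply: ae_eq_integral => //.
    - exact/measurable_EFinP.
    - exact/measurable_EFinP.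
    - exists N; split => // x /= H; apply: contrapT => xN; apply: H => _.
      by rewrite /gN indicE in_setC memNset// mul1r.
  rewrite (eq_integral (fun x => (n.+1%:R)%:E *
      ((F (T n.+1%:R^-1 x))%:E - (F x)%:E))%E); last first.
    by move=> x _; rewrite /g /quo invrK EFinM EFinB.
  rewrite integralZl//; last exact: integrableB.
  rewrite integralB// eFT subee ?mule0//.
  exact: integrable_fin_num.
exists N, dF; split => //.
- have H : (\int[mu]_x (gN n x)%:E)%E @[n --> \oo] --> (\int[mu]_x (dF x)%:E)%E.
    apply: (@dominated_cvg _ _ _ mu _ measurableT (fun n => EFin \o gN n)
      (EFin \o dF) (EFin \o (fun x => K * \1_D x))) => //.
    + by move=> n; exact/measurable_EFinP.
    + by move=> x _; apply: cvg_EFin; [near=> n|exact: dFcvg].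
    + by move=> n x _; rewrite /= lee_fin.
  apply/esym; apply: (cvg_unique (@ereal_hausdorff R) _ H).
  rewrite (_ : (fun n => _) = cst 0%E); first exact: cvg_cst.
  by apply/funext => n; exact: int0.
- move=> x xN; have dx := dN x xN.
  by apply: DeriveDef; [exact: dx|rewrite /dF memNset].
Unshelve. all: by end_near. Qed.

End flow.

(** * Space-time measure *)

Section spacetime_measure.
Context {R : realType} {m : nat}.
Local Notation leb := (@lebesgue_measure R).
Local Notation tupR := (m.-tuple (measurableTypeR R)).
Local Notation X := (measurableTypeR R * tupR)%type.

Definition spacetime_point (x : X) : R * 'rV[R]_m := (x.1, row_of_tuple x.2).

Definition translate (u : R * 'rV[R]_m) (s : R) (x : X) : X :=
  (s * u.1 + x.1, add_tup [tuple s * u.2 0 i | i < m] x.2).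

Lemma point_translate u s x : spacetime_point (translate u s x) = s *: u + spacetime_point x.
Proof.
rewrite /spacetime_point /translate /=; congr pair; apply/rowP => i.
by rewrite !mxE /add_tup !tnth_mktuple.
Qed.

Lemma point_inj : injective spacetime_point.
Proof.
move=> [t x] [t' x'] /= [-> xx']; congr pair; apply: eq_from_tnth => i.
by have /rowP/(_ i) := xx'; rewrite !mxE.
Qed.

Definition spacetime_measure : set X -> \bar R := (leb \x lebesgue_tuple m)%E.

HB.instance Definition _ := Measure.on spacetime_measure.

Lemma spacetime_measure_sigma_finite : sigma_finite setT spacetime_measure.
Proof.
have [F [TF ndF Foo]] := (sigma_finiteP _ _).1 (@sigma_finiteT _ _ _ leb).
have [G [TG ndG Goo]] := (sigma_finiteP _ _).1 (sigma_finiteT (@lebesgue_tuple R m)).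
exists (fun k => F k `*` G k).
  apply/esym; rewrite -subTset => x _ /=.
  have [p _ Fp] : (\bigcup_i F i) x.1 by rewrite -TF.
  have [q _ Gq] : (\bigcup_i G i) x.2 by rewrite -TG.
  exists (maxn p q) => //; split.
  - by move: Fp; exact/subsetPset/ndF/leq_maxl.
  - by move: Gq; exact/subsetPset/ndG/leq_maxr.
move=> k; have [mF Fk] := Foo k; have [mG Gk] := Goo k; split.
  exact: measurableX.
rewrite /spacetime_measure (product_measure1E leb (lebesgue_tuple m) mF mG).
by rewrite lte_mul_pinfty// ge0_fin_numE.
Qed.

HB.instance Definition _ := Measure_isSigmaFinite.Build _ _ _
  spacetime_measure spacetime_measure_sigma_finite.

Lemma measure_flow_translate u : measure_flow spacetime_measure (translate u).
Proof.
split.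
- by move=> x; apply: point_inj; rewrite point_translate scale0r add0r.
- by move=> s r x; apply: point_inj; rewrite !point_translate scalerDl addrA.
- apply: measurable_fun_pair.
    apply: measurable_funD; last exact: measurableT_comp.
    by apply: measurable_funM => //; exact: measurable_cst.
  apply/measurable_fun_tnthP => i.
  have -> : (fun t : tupR => tnth t i) \o
      (fun z : measurableTypeR R * X => add_tup [tuple z.1 * u.2 0 i | i < m] z.2.2) =
      (fun z => z.1 * u.2 0 i + tnth z.2.2 i).
    by apply/funext => z; rewrite /= !tnth_mktuple.
  apply: measurable_funD.
    by apply: measurable_funM => //; exact: measurable_cst.
  have m22 : measurable_fun setT (fun z : measurableTypeR R * X => z.2.2).
    exact: (measurableT_comp measurable_snd measurable_snd).
  exact: (measurableT_comp (measurable_tnth i) m22).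
- move=> s.
  exact: (preserves_prod (preserves_lebesgue_shift (s * u.1))
    (preserves_add_tup [tuple s * u.2 0 i | i < m])).
Qed.

Let rbox (p : rat * m.-tuple rat * nat) : set X :=
  [set x | `|ratr p.1.1 - x.1| < p.2.+1%:R^-1 /\
    forall i, `|ratr (tnth p.1.2 i) - tnth x.2 i| < p.2.+1%:R^-1].

Let measurable_rbox p : measurable (rbox p).
Proof.
have mb (q : rat) (r : R) : measurable
    ([set y : R | `|ratr q - y| < r] : set (measurableTypeR R)).
  exact: (measurable_ball (ratr q : R) r).
have -> : rbox p = [set y : R | `|ratr p.1.1 - y| < p.2.+1%:R^-1] `*`
    \bigcap_(i in [set: 'I_m]) ((fun x : tupR => tnth x i) @^-1`
      [set y : R | `|ratr (tnth p.1.2 i) - y| < p.2.+1%:R^-1]).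
  apply/seteqP; split => x /= [H1 H2]; split => //= i; first by move=> _; exact: H2.
  exact: H2.
apply: measurableX => //; apply: fin_bigcap_measurable => // i _.
by apply: measurable_preimage; [exact: measurable_tnth|exact: mb].
Qed.

(** Links the norm topology with the product sigma-algebra: an open set is the union of the rational
    boxes that it contains, a countable family. *)
Lemma measurable_open_point (U : set (R * 'rV[R]_m)) :
  open U -> measurable (spacetime_point @^-1` U).
Proof.
move=> oU.
have -> : spacetime_point @^-1` U = \bigcup_(j : nat)
    (if @unpickle (rat * m.-tuple rat * nat)%type j is Some p then
       (if `[< rbox p `<=` spacetime_point @^-1` U >] then rbox p else set0) else set0).
  apply/seteqP; split => x; last first.
    move=> [j _]; case: (unpickle j) => // p.
    by case: asboolP => // + rx; apply.
  move=> Ux; have : nbhs (spacetime_point x) U by apply: open_nbhs_nbhs; split.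
  move=> /nbhs_ballP[e /= e0 He].
  (* Two box radii must fit into e: one from the given point to the rational centre, one from the
     centre to any other point of the box. *)
  pose k := Num.truncn (2 / e).
  have ke : k.+1%:R^-1 + k.+1%:R^-1 < e.
    rewrite -mulr2n -[X in X *+ _]mul1r -mulrnAl ltr_pdivrMr// mulrC -ltr_pdivrMr//.
    exact: truncnS_gt.
  have near_rat (y : R) : exists q : rat, `|ratr q - y| < k.+1%:R^-1.
    have yk : y < y + k.+1%:R^-1 by rewrite ltrDl invr_gt0.
    have [q] := rat_in_itvoo yk; rewrite in_itv/= => /andP[q1 q2].
    by exists q; rewrite gtr0_norm ?subr_gt0// ltrBlDl.
  have [q0 Hq0] := near_rat x.1.
  have [q Hq] := choice (fun i : 'I_m => near_rat (tnth x.2 i)).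
  pose p := (q0, [tuple q i | i < m], k).
  have px : rbox p x by split => //= i; rewrite tnth_mktuple.
  exists (pickle p); first exact: I.
  rewrite pickleK.
  case: asboolP => // -[] y [/= y0 yi]; apply: He; split => /=.
    rewrite /ball/=; apply: le_lt_trans ke.
    rewrite -[X in `|X|](subrKA (ratr q0)) (le_trans (ler_normD _ _))// lerD//.
      by rewrite distrC ltW.
    exact: ltW.
  split=> // i j; rewrite /ball/= !mxE; apply: le_lt_trans ke.
  rewrite -[X in `|X|](subrKA (ratr (q j))) (le_trans (ler_normD _ _))// lerD//.
    by rewrite distrC ltW.
  by have := yi j; rewrite tnth_mktuple => /ltW.
apply: bigcup_measurable => j _; case: (unpickle j) => // p.
by case: ifP.
Qed.

Lemma measurable_continuous_point (f : R * 'rV[R]_m -> R) :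
  continuous f -> measurable_fun setT (f \o spacetime_point).
Proof.
move=> /continuousP cf; apply: (measurability _ (RGenOpens.measurableE R)) => //.
move=> _ [_ [a [b ->]] <-]; rewrite setTI comp_preimage.
apply: measurable_open_point; apply: cf; exact: interval_open.
Qed.

Definition cylinder (r : R) : set X := `[- r, r]%classic `*` box r.

Lemma measurable_cylinder r : measurable (cylinder r).
Proof. by apply: measurableX; [exact: measurable_itv|exact: measurable_box]. Qed.

Lemma cylinder_lty r : (spacetime_measure (cylinder r) < +oo)%E.
Proof.
have mI : measurable (`[- r, r]%classic : set (measurableTypeR R)).
  exact: measurable_itv.
rewrite /spacetime_measure /cylinder.
rewrite (product_measure1E leb (lebesgue_tuple m) mI (measurable_box r)).
apply: lte_mul_pinfty; [exact: measure_ge0| |exact: lebesgue_tuple_box_lty].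
rewrite ge0_fin_numE; last exact: measure_ge0.
have fI : (leb [set x : R | x \in `[(- r)%R, r]] < +oo)%E.
  by rewrite lebesgue_measure_itv/=; case: ifP => // _; rewrite ltry.
exact: fI.
Qed.

Lemma cylinderP r x : cylinder r x <-> `|x.1| <= r /\ forall i, `|tnth x.2 i| <= r.
Proof.
split.
  by move=> [] /=; rewrite in_itv/= -ler_norml => ? H; split.
by move=> [H1 H2]; split => //=; rewrite in_itv/= -ler_norml.
Qed.

End spacetime_measure.

(** * Directional derivatives *)

Section directional_derivatives.
Context {R : realType} {V : normedModType R}.
Implicit Types (f g : V -> R) (u v p : V).

Let growth_rate_line f u p :
  (fun h : R => h^-1 *: ((f \o shift p) (h *: u) - f p)) =
  (fun h : R => h^-1 *: (((fun s : R => f (s *: u + p)) \o shift 0) (h *: 1) -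
    (fun s : R => f (s *: u + p)) 0)).
Proof.
apply/funext => h /=; have -> : h *: (1 : R) = h by exact: mulr1.
by rewrite addr0 scale0r add0r.
Qed.

Lemma is_derive_line f u p d :
  is_derive p u f d <-> is_derive (0 : R) 1 (fun s : R => f (s *: u + p)) d.
Proof.
by split => -[df fE]; split; move: df fE; rewrite /derivable /derive growth_rate_line.
Qed.

Lemma derive_line f u p :
  'D_u f p = 'D_1 (fun s : R => f (s *: u + p)) (0 : R).
Proof.
by rewrite /derive growth_rate_line.
Qed.

Lemma is_derive_line_at f u p (s : R) : derivable f (s *: u + p) u ->
  is_derive s 1 (fun r : R => f (r *: u + p)) ('D_u f (s *: u + p)).
Proof.
have E : (fun h : R => h^-1 *: ((f \o shift (s *: u + p)) (h *: u) - f (s *: u + p))) =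
    (fun h : R => h^-1 *: (((fun r : R => f (r *: u + p)) \o shift s) (h *: 1) -
      (fun r : R => f (r *: u + p)) s)).
  apply/funext => h /=; have -> : h *: (1 : R) = h by exact: mulr1.
  by rewrite scalerDl addrA.
by move=> df; split; move: df; rewrite /derivable /derive E.
Qed.

Lemma mean_value_direction f u p (h : R) :
  (forall q, derivable f q u) -> 0 <= h ->
  exists2 s, 0 <= s <= h & f (h *: u + p) - f p = 'D_u f (s *: u + p) * h.
Proof.
move=> df h0.
have dl (s : R) : is_derive s 1 (fun r : R => f (r *: u + p)) ('D_u f (s *: u + p)).
  exact: is_derive_line_at.
have [|s sI] := @MVT_segment R (fun r : R => f (r *: u + p)) _ 0 h h0 (fun s _ => dl s).
  apply: continuous_subspaceT => s.
  by apply: differentiable_continuous; apply/derivable1_diffP; have [] := dl s.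
rewrite scale0r add0r subr0 => sE; exists s => //.
Qed.

Lemma lipschitz_direction f u (L : R) :
  (forall q, derivable f q u) -> (forall q, `|'D_u f q| <= L) ->
  forall p s, `|f (s *: u + p) - f p| <= L * `|s|.
Proof.
move=> df dL p s.
wlog s0 : p s / 0 <= s => [H|].
  have [|s0] := leP 0 s; first exact: H.
  have := H (s *: u + p) (- s); rewrite scaleNr addKr normrN distrC.
  by apply; rewrite oppr_ge0 ltW.
have [r _ ->] := mean_value_direction p df s0.
by rewrite normrM ler_wpM2r.
Qed.

Lemma is_derive_off_support (S : set V) f u p : closed S ->
  (forall q, ~ S q -> f q = 0) -> ~ S p -> is_derive p u f 0.
Proof.
move=> cS f0 Sp; have d0 : is_derive p u (cst 0 : V -> R) 0 by exact: is_derive_cst.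
apply: near_eq_is_derive d0; have : nbhs p (~` S) by apply: open_nbhs_nbhs; split => //; exact: closed_openC.
by apply: filterS => q /f0 ->.
Qed.

(** Two applications of the mean value theorem: along u to the increment of f in direction v, then
    along v to the derivative of f along u. *)
Let second_difference f u v p (h : R) : 0 <= h ->
  (forall q, derivable f q u) -> (forall q, derivable ('D_u f) q v) ->
  exists s r, [/\ 0 <= s <= h, 0 <= r <= h &
    f (h *: u + (h *: v + p)) - f (h *: u + p) - (f (h *: v + p) - f p) =
    'D_v ('D_u f) (r *: v + (s *: u + p)) * h * h].
Proof.
move=> h0 du dv.
pose g q := f (q + h *: v) - f q.
have dg q : is_derive q u g ('D_u f (q + h *: v) - 'D_u f q).
  apply/is_derive_line; apply: is_deriveB; last exact/is_derive_line/derivableP.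
  have /derivableP/is_derive_line := du (q + h *: v).
  by under eq_fun do rewrite addrA.
have [s sh sE] := mean_value_direction p (fun q => @ex_derive _ _ _ _ _ _ _ (dg q)) h0.
have [r rh rE] := mean_value_direction (s *: u + p) dv h0.
exists s, r; split => //.
rewrite -rE -(addrC (s *: u + p)) -(@derive_val _ _ _ _ _ _ _ (dg (s *: u + p))) -sE /g.
rewrite -!addrA (addrC p); ring.
Qed.

(** The second difference is symmetric in u and v, so the two mixed derivatives take a common value
    at points arbitrarily close to p; continuity at p does the rest. *)
Lemma derive_swap f u v p :
  (forall q, derivable f q u) -> (forall q, derivable f q v) ->
  (forall q, derivable ('D_u f) q v) -> (forall q, derivable ('D_v f) q u) ->
  {for p, continuous ('D_v ('D_u f))} -> {for p, continuous ('D_u ('D_v f))} ->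
  'D_v ('D_u f) p = 'D_u ('D_v f) p.
Proof.
move=> du dv duv dvu cuv cvu; apply/eqP; rewrite -subr_eq0 -normr_le0.
apply/ler_addgt0Pr => e e0; rewrite add0r.
have e2 : 0 < e / 2 by rewrite divr_gt0.
move/cvgrPdist_le : cuv => /(_ _ e2)/nbhs_ballP[d1 /= d10 H1].
move/cvgrPdist_le : cvu => /(_ _ e2)/nbhs_ballP[d2 /= d20 H2].
pose d := Num.min d1 d2.
have d0 : 0 < d by rewrite lt_min d10.
pose h := d / (2 * (`|u| + `|v| + 1)).
have uv0 : 0 < `|u| + `|v| + 1 by rewrite ltr_wpDl// addr_ge0.
have h0 : 0 < h by rewrite divr_gt0// mulr_gt0.
have hb (w w' : V) s r : `|w| + `|w'| <= `|u| + `|v| -> 0 <= s <= h -> 0 <= r <= h ->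
    ball p d (r *: w + (s *: w' + p)).
  move=> ww /andP[s0 sh] /andP[r0 rh].
  rewrite -ball_normE /= addrA [X in _ - X]addrC opprD addNKr normrN.
  apply: (@le_lt_trans _ _ (h * (`|u| + `|v|))).
    rewrite (le_trans (ler_normD _ _))// !normrZ !ger0_norm//.
    rewrite (@le_trans _ _ (h * `|w| + h * `|w'|))//.
      by apply: lerD; apply: ler_wpM2r.
    by rewrite -mulrDr ler_wpM2l// ltW.
  apply: (@lt_le_trans _ _ (h * (2 * (`|u| + `|v| + 1)))).
    have : 0 <= `|u| + `|v| by rewrite addr_ge0.
    by rewrite ltr_pM2l//; lra.
  by rewrite /h divfK// gt_eqF// mulr_gt0.
have [s [r [sh rh E1]]] := second_difference p (ltW h0) du duv.
have [s' [r' [sh' rh' E2]]] := second_difference p (ltW h0) dv dvu.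
have EE : 'D_v ('D_u f) (r *: v + (s *: u + p)) = 'D_u ('D_v f) (r' *: u + (s' *: v + p)).
  have hN0 : h != 0 by rewrite gt_eqF.
  apply: (mulIf hN0); apply: (mulIf hN0).
  apply: etrans (esym E1) _; apply: etrans _ E2.
  by rewrite (addrCA (h *: u)) opprB opprB addrACA [RHS]addrACA [- f (h *: u + p) + _]addrC.
have B1 : `|'D_v ('D_u f) p - 'D_v ('D_u f) (r *: v + (s *: u + p))| <= e / 2.
  apply: H1; apply: (@le_ball _ _ _ d); first by rewrite ge_min lexx.
  by apply: (hb v u s r _ sh rh); rewrite addrC.
have B2 : `|'D_u ('D_v f) p - 'D_u ('D_v f) (r' *: u + (s' *: v + p))| <= e / 2.
  apply: H2; apply: (@le_ball _ _ _ d); first by rewrite ge_min lexx orbT.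
  by apply: (hb u v s' r' _ sh' rh').
rewrite (splitr e); move: B1 B2; rewrite EE.
set a := 'D_v _ p; set b := 'D_u _ p; set c := 'D_u _ _ => B1 B2.
have -> : a - b = (a - c) - (b - c) by ring.
exact: le_trans (ler_normB _ _) (lerD B1 B2).
Qed.

(* Where g vanishes the difference quotient of f g converges to f p * g', with no
   derivative of f involved; elsewhere f = (f g) / g is differentiable too. *)
Lemma derive_factor_bound f g u p (d g' L : R) : {for p, continuous f} ->
  is_derive p u (f \* g) d -> is_derive p u g g' -> `|'D_u f p| <= L ->
  `|d - f p * g'| <= L * `|g p|.
Proof.
move=> cf dfg dg fL.
have cl : {for (0 : R), continuous (fun s : R => f (s *: u + p))}.
  have cs : {for (0 : R), continuous (fun s : R => s *: u + p)}.
    apply: cvgD; last exact: cvg_cst.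
    by apply: cvgZr_tmp; exact: cvg_id.
  by apply: (continuous_comp cs); rewrite scale0r add0r.
move: dfg => /is_derive_line dfg; move: dg => /is_derive_line dg.
move: fL; rewrite derive_line.
set a := (fun s : R => f (s *: u + p)) in cl *.
set G := (fun s : R => g (s *: u + p)) in dg *.
have -> : f p = a 0 by rewrite /a scale0r add0r.
have -> : g p = G 0 by rewrite /G scale0r add0r.
have {}dfg : is_derive (0 : R) 1 (a \* G) d by exact: dfg.
move=> aL.
have L0 : 0 <= L by apply: le_trans aL.
have [G0|G0] := eqVneq (G 0) 0.
  suff -> : d = a 0 * g' by rewrite subrr normr0 mulr_ge0.
  have [dfg1 dfg2] := dfg; have [dg1 dg2] := dg.
  have l1 : h^-1 *: (((a \* G) \o shift 0) (h *: 1) - (a \* G) 0) @[h --> (0 : R)^'] --> d.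
    by rewrite -dfg2; exact: dfg1.
  have l2 : h^-1 *: ((G \o shift 0) (h *: 1) - G 0) @[h --> (0 : R)^'] --> g'.
    by rewrite -dg2; exact: dg1.
  have l3 : a h @[h --> (0 : R)^'] --> a 0.
    by apply: cvg_within_filter; exact: cl.
  have E : (fun h : R => h^-1 *: (((a \* G) \o shift 0) (h *: 1) - (a \* G) 0)) =
      (a \* (fun h : R => h^-1 *: ((G \o shift 0) (h *: 1) - G 0))).
    apply/funext => h; rewrite /= G0 mulr0 !subr0 /GRing.scale /= mulr1 addr0.
    by rewrite mulrCA.
  move: l1; rewrite E => l1.
  have l4 : (a \* (fun h : R => h^-1 *: ((G \o shift 0) (h *: 1) - G 0))) h
      @[h --> (0 : R)^'] --> a 0 * g' by exact: cvgM l3 l2.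
  exact: (cvg_unique (@Rhausdorff R) l1 l4).
have dG1 : derivable G (0 : R) 1 by have [] := dg.
have cG : {for (0 : R), continuous G}.
  by move/derivable1_diffP/differentiable_continuous : dG1.
have aE : \forall s \near (0 : R), ((a \* G) \* (fun s => (G s)^-1)) s = a s.
  near=> s; rewrite /= mulfK//; near: s.
  exact: (cvgr_neq0 _ cG G0).
have da : is_derive (0 : R) 1 a (a 0 * G 0 * (- (G 0) ^- 2 * g') + (G 0)^-1 * d).
  have dV : is_derive (0 : R) 1 (fun s => (G s)^-1) (- (G 0) ^- 2 * g').
    apply: DeriveDef; first exact: derivableV.
    by rewrite deriveV//; have [_ ->] := dg.
  exact: near_eq_is_derive aE (is_deriveM dfg dV).
have -> : d - a 0 * g' = 'D_1 a 0 * G 0.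
  by rewrite (@derive_val _ _ _ _ _ _ _ da); field.
by rewrite normrM ler_wpM2r.
Unshelve. all: by end_near. Qed.

End directional_derivatives.

(** * Lipschitz functions with compact support *)

Section lipschitz_supported.
Context {R : realType} {m : nat}.
Local Notation ST := (R * 'rV[R]_m)%type.
Local Notation X := (measurableTypeR R * m.-tuple (measurableTypeR R))%type.
Local Notation mu := (@spacetime_measure R m).

Lemma normr_coord_le (p : ST) : `|p.1| <= `|p| /\ forall i, `|p.2 0 i| <= `|p|.
Proof.
rewrite prod_normE /=; split; first by rewrite le_max lexx.
move=> i; rewrite le_max; apply/orP; right.
by rewrite [leRHS]/Num.norm /= mx_normrE; apply/bigmax_geP; right; exists (0, i).
Qed.

Variable S : set ST.
Hypothesis cS : compact S.

Lemma compact_coord_bounded : exists2 r, 0 <= r & forall p, S p ->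
  `|p.1| <= r /\ forall i, `|p.2 0 i| <= r.
Proof.
have [M [_ MS]] := compact_bounded cS.
exists (`|M| + 1) => [|p Sp]; first by rewrite addr_ge0.
have pr : `|p| <= `|M| + 1.
  by apply: (MS _ _ p Sp); rewrite (le_lt_trans (ler_norm M))// ltrDl.
have [p1 p2] := normr_coord_le p.
by split => [|i]; [exact: le_trans p1 pr|exact: le_trans (p2 i) pr].
Qed.

Lemma compact_support_closed : closed S.
Proof. by apply: compact_closed => //; exact: norm_hausdorff. Qed.

(** The class of admissible fluxes in direction u. Lipschitz continuity is required along u only: a
    flux to be differentiated in v may contain factors that are merely measurable and bounded in t,
    such as the frequency. *)
Definition lip_supported (u : ST) (f : ST -> R) : Prop :=
  [/\ measurable_fun [set: X] (f \o spacetime_point), forall p, ~ S p -> f p = 0,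
    exists B, forall p, `|f p| <= B &
    exists L, forall p s, `|f (s *: u + p) - f p| <= L * `|s|].

(** What is retained of the a.e. derivative of a flux. In this form finite sums and multiples of
    divergences in different directions can be collected into one function. *)
Definition null_divergence (d : X -> R) : Prop :=
  [/\ measurable_fun setT d, mu.-integrable setT (EFin \o d) &
    (\int[mu]_x (d x)%:E = 0)%E].

Lemma null_divergenceD d1 d2 : null_divergence d1 -> null_divergence d2 ->
  null_divergence (fun x => d1 x + d2 x).
Proof.
move=> [m1 i1 e1] [m2 i2 e2]; split.
- exact: measurable_funD.
- by apply: (integrableD measurableT i1 i2).
- under eq_integral do rewrite EFinD.
  by rewrite integralD// e1 e2 adde0.
Qed.

Lemma null_divergence0 : null_divergence (fun=> 0).
Proof.
split; [exact: measurable_cst| |by rewrite integral0].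
exact: integrable0.
Qed.

Lemma null_divergence_sum I (r : seq I) (d : I -> X -> R) :
  (forall i, null_divergence (d i)) ->
  null_divergence (fun x => \sum_(i <- r) d i x).
Proof.
move=> nd; elim: r => [|i r IH].
  by under eq_fun do rewrite big_nil; exact: null_divergence0.
by under eq_fun do rewrite big_cons; exact: null_divergenceD.
Qed.

Lemma lip_supported_flux (u : ST) (f : ST -> R) : lip_supported u f ->
  exists (N : set X) (d : X -> R), [/\ measurable N, mu N = 0%E,
    null_divergence d & forall x : X, ~ N x -> is_derive (spacetime_point x : ST) u f (d x)].
Proof.
move=> [mf f0 [B fB] [L fL]].
have [r r0 rS] := compact_coord_bounded.
have [u1 u2] := normr_coord_le u.
(* The radius is enlarged by |u|: from outside the larger cylinder a step s u with |s| <= 1 cannot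
   reach S. *)
have [|||||N [d [[mN N0] md id e dN]]] := @flow_integral_derive _ _ _ mu (translate u)
    (measure_flow_translate u) (f \o spacetime_point) L mf _ B (cylinder (r + `|u|)).
- by move=> s x; rewrite /= point_translate.
- by move=> x; exact: fB.
- exact: measurable_cylinder.
- exact: cylinder_lty.
- move=> x s xD s1; rewrite /= point_translate; apply: f0 => /rS [/= p1 p2].
  have su (a : R) : `|a| <= `|u| -> `|s * a| <= `|u|.
    by move=> au; rewrite normrM (le_trans _ au)// ler_piMl.
  apply: xD; apply/cylinderP; split.
    rewrite -[x.1](addKr (s * u.1)) (le_trans (ler_normD _ _))// normrN addrC lerD//.
    exact: su.
  move=> i; have := p2 i; rewrite !mxE => p2i.
  rewrite -[tnth x.2 i](addKr (s * u.2 0 i)) (le_trans (ler_normD _ _))// normrN.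
  by rewrite addrC lerD// su.
exists N, d; split => // x xN.
apply/is_derive_line; have := dN x xN.
by under eq_fun do rewrite /= point_translate.
Qed.

Lemma lip_supported_integrable u f : lip_supported u f ->
  mu.-integrable setT (EFin \o (f \o spacetime_point)).
Proof.
move=> [mf f0 [B fB] _]; have [r r0 rS] := compact_coord_bounded.
apply: (integrable_bounded_support mf _ (measurable_cylinder r) (cylinder_lty r)).
  by move=> x; exact: fB.
move=> x xr; apply: f0 => /rS [/= p1 p2]; apply: xr; apply/cylinderP; split => // i.
by have := p2 i; rewrite mxE.
Qed.

(** The factor k is controlled on S only, as are A and the weights. If one end of the step lies
    outside S, the product vanishes there and the Lipschitz bound of f alone controls the
    difference. *)
Lemma lip_supported_mul u k f : lip_supported u f ->
  measurable_fun [set: X] ((fun p => k p * f p) \o spacetime_point) ->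
  (exists B, forall p, S p -> `|k p| <= B) ->
  (exists L, forall p s, S p -> S (s *: u + p) ->
     `|k (s *: u + p) - k p| <= L * `|s|) ->
  lip_supported u (fun p => k p * f p).
Proof.
move=> [mf f0 [B fB] [L fL]] mkf [Bk kB] [Lk kL].
have B0 : 0 <= B by apply: le_trans (fB 0).
have kB' p : S p -> `|k p| <= `|Bk|.
  by move=> /kB kp; exact: le_trans kp (ler_norm _).
split => //.
- by move=> p Sp; rewrite f0// mulr0.
- exists (`|Bk| * B) => p; have [Sp|Sp] := pselect (S p).
    by rewrite normrM ler_pM// kB'.
  by rewrite f0// mulr0 normr0 mulr_ge0.
- exists (`|Lk| * B + `|Bk| * `|L|) => p s.
  have fL' : `|f (s *: u + p) - f p| <= `|L| * `|s|.
    by rewrite (le_trans (fL p s))// ler_wpM2r// ler_norm.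
  have Ls : 0 <= `|Lk| * B * `|s| by rewrite !mulr_ge0.
  have Bs : 0 <= `|Bk| * `|L| * `|s| by rewrite !mulr_ge0.
  rewrite mulrDl.
  have [Sp|Sp] := pselect (S p); have [Sq|Sq] := pselect (S (s *: u + p)).
  + have -> : k (s *: u + p) * f (s *: u + p) - k p * f p =
      (k (s *: u + p) - k p) * f (s *: u + p) + k p * (f (s *: u + p) - f p) by ring.
    rewrite (le_trans (ler_normD _ _))// lerD// normrM.
      rewrite -mulrA [B * _]mulrC mulrA ler_pM//.
      by rewrite (le_trans (kL _ _ Sp Sq))// ler_wpM2r// ler_norm.
    by rewrite -mulrA ler_pM// kB'.
  + rewrite (f0 _ Sq) mulr0 sub0r normrN normrM -[leLHS]add0r lerD//.
    rewrite -mulrA ler_pM ?kB'//.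
    by move: fL'; rewrite (f0 _ Sq) sub0r normrN.
  + rewrite (f0 _ Sp) mulr0 subr0 normrM -[leLHS]add0r lerD//.
    rewrite -mulrA ler_pM ?kB'//.
    by move: fL'; rewrite (f0 _ Sp) subr0.
  + by rewrite (f0 _ Sp) (f0 _ Sq) !mulr0 subrr normr0 addr_ge0.
Qed.

Lemma lip_supportedD u f g : lip_supported u f -> lip_supported u g ->
  lip_supported u (fun p => f p + g p).
Proof.
move=> [mf f0 [B fB] [L fL]] [mg g0 [B' gB] [L' gL]]; split.
- exact: measurable_funD.
- by move=> p Sp; rewrite f0// g0// addr0.
- by exists (B + B') => p; rewrite (le_trans (ler_normD _ _))// lerD.
- exists (L + L') => p s; rewrite opprD addrACA mulrDl.
  by rewrite (le_trans (ler_normD _ _))// lerD.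
Qed.

Lemma lip_supported_scale u c f : lip_supported u f ->
  lip_supported u (fun p => c * f p).
Proof.
move=> lf; apply: (lip_supported_mul (k := cst c)) => //.
- by have [mf _ _ _] := lf; apply: measurable_funM => //; exact: measurable_cst.
- by exists `|c|.
- by exists 0 => p s _ _; rewrite /= subrr normr0 mul0r.
Qed.

Lemma lip_supportedM u f g : lip_supported u f -> lip_supported u g ->
  lip_supported u (fun p => f p * g p).
Proof.
move=> [mf f0 [B fB] [L fL]] lg; apply: lip_supported_mul => //.
- by have [mg _ _ _] := lg; exact: measurable_funM.
- by exists B.
- by exists L.
Qed.

Lemma lip_supported_sum u I (r : seq I) (F : I -> ST -> R) :
  (forall i, lip_supported u (F i)) ->
  lip_supported u (fun p => \sum_(i <- r) F i p).
Proof.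
move=> lF; elim: r => [|i r IH]; last first.
  by under eq_fun do rewrite big_cons; exact: lip_supportedD.
under eq_fun do rewrite big_nil; split => //.
- exact: measurable_cst.
- by exists 0 => p; rewrite normr0.
- by exists 0 => p s; rewrite subrr normr0 mul0r.
Qed.

Definition smooth_supported (f : ST -> R) : Prop :=
  smooth f /\ forall p, ~ S p -> f p = 0.

Lemma smooth_supported_continuous (f : ST -> R) :
  smooth_supported f -> continuous f.
Proof. by move=> [/(_ [::])[]]. Qed.

Lemma smooth_supported_derivable (f : ST -> R) (u p : ST) : smooth_supported f -> derivable f p u.
Proof. by move=> [/(_ [::])[_]] /(_ u p). Qed.

Lemma smooth_supported_derive (u : ST) (f : ST -> R) :
  smooth_supported f -> smooth_supported ('D_u f).
Proof.
move=> [sf f0]; split; last first.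
  move=> p Sp.
  have d0 := is_derive_off_support u compact_support_closed f0 Sp.
  by rewrite (@derive_val _ _ _ _ _ _ _ d0).
move=> us; have := sf (rcons us u).
by rewrite foldr_rcons.
Qed.

Lemma supported_bounded (f : ST -> R) : continuous f -> (forall p, ~ S p -> f p = 0) ->
  exists B, forall p, `|f p| <= B.
Proof.
move=> cf f0.
have cfS : {within S, continuous f} by exact: continuous_subspaceT.
have [M [_ MS]] := compact_bounded (continuous_compact cfS cS).
exists (`|M| + 1) => p; have [Sp|Sp] := pselect (S p); last first.
  by rewrite f0// normr0 addr_ge0.
apply: MS; last by exists p.
by rewrite (le_lt_trans (ler_norm M))// ltrDl.
Qed.

Lemma smooth_supported_lip u f : smooth_supported f -> lip_supported u f.
Proof.
move=> sf; have [_ f0] := sf; have cf := smooth_supported_continuous sf.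
split => //.
- exact: measurable_continuous_point.
- exact: supported_bounded.
- have [sd d0] := smooth_supported_derive u sf.
  have [L dL] := supported_bounded (smooth_supported_continuous (conj sd d0)) d0.
  exists L; apply: lipschitz_direction => // q.
  exact: smooth_supported_derivable.
Qed.

Lemma smooth_supported_swap (u v : ST) (f : ST -> R) (p : ST) : smooth_supported f ->
  'D_v ('D_u f) p = 'D_u ('D_v f) p.
Proof.
move=> sf.
have su := smooth_supported_derive u sf; have sv := smooth_supported_derive v sf.
have svu := smooth_supported_derive v su; have suv := smooth_supported_derive u sv.
have d1 q : derivable f q u := @smooth_supported_derivable _ u q sf.
have d2 q : derivable f q v := @smooth_supported_derivable _ v q sf.
have d3 q : derivable ('D_u f) q v := @smooth_supported_derivable _ v q su.
have d4 q : derivable ('D_v f) q u := @smooth_supported_derivable _ u q sv.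
have c1 : {for p, continuous ('D_v ('D_u f))} :=
  @smooth_supported_continuous _ svu p.
have c2 : {for p, continuous ('D_u ('D_v f))} :=
  @smooth_supported_continuous _ suv p.
exact (derive_swap d1 d2 d3 d4 c1 c2).
Qed.

Variable t2 : R.
Hypothesis St2 : S `<=` slab t2.

Lemma measurable_time (c : R -> R) : measurable_fun setT c ->
  measurable_fun setT (fun x : X => c (spacetime_point x).1).
Proof. by move=> mc; exact: (measurableT_comp mc measurable_fst). Qed.

(** Time is constant along [e_v i], so no regularity of c in t enters. *)
Lemma lip_supported_time_v i (c : R -> R) f : measurable_fun setT c ->
  (exists B, forall t, 0 < t < t2 -> `|c t| <= B) ->
  lip_supported (e_v i) f -> lip_supported (e_v i) (fun p => c p.1 * f p).
Proof.
move=> mc [B cB] lf; apply: (lip_supported_mul (k := fun p => c p.1)) => //.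
- have [mf _ _ _] := lf.
  exact: (measurable_funM (measurable_time mc) mf).
- by exists B => p /St2; exact: cB.
- by exists 0 => p s _ _; rewrite /= scaler0 add0r subrr normr0 mul0r.
Qed.

Lemma lip_supported_coord u j f :
  lip_supported u f -> lip_supported u (fun p => p.2 0 j * f p).
Proof.
move=> lf; have [r r0 rS] := compact_coord_bounded.
apply: (lip_supported_mul (k := fun p => p.2 0 j)) => //.
- have [mf _ _ _] := lf; apply: (measurable_funM _ mf).
  rewrite [X in measurable_fun _ X](_ : _ = fun x : X => tnth x.2 j).
    exact: (measurableT_comp (measurable_tnth j) measurable_snd).
  by apply/funext => x; rewrite /= mxE.
- by exists r => p /rS [].
- by exists `|u.2 0 j| => p s _ _; rewrite !mxE addrK normrM mulrC.
Qed.

Lemma lip_supported_time_t (c dc : R -> R) (L : R) f : measurable_fun setT c ->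
  (exists B, forall t, 0 < t < t2 -> `|c t| <= B) ->
  (forall t, 0 < t < t2 -> is_derive t 1 c (dc t)) ->
  (forall t, 0 < t < t2 -> `|dc t| <= L) ->
  lip_supported e_t f -> lip_supported e_t (fun p => c p.1 * f p).
Proof.
move=> mc [B cB] dcE dcL lf; apply: (lip_supported_mul (k := fun p => c p.1)) => //.
- have [mf _ _ _] := lf.
  exact: (measurable_funM (measurable_time mc) mf).
- by exists B => p /St2; exact: cB.
- have H (a a' : R) : 0 < a < t2 -> 0 < a' < t2 -> a <= a' -> `|c a' - c a| <= L * `|a' - a|.
    move=> /andP[a0 at2] /andP[a0' at2'] aa.
    have sub x : x \in `[a, a'] -> 0 < x < t2.
      by rewrite in_itv/= => /andP[ax xa]; rewrite (lt_le_trans a0)//= (le_lt_trans xa).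
    have [x xa||x xa ->] := @MVT_segment R c dc a a' aa.
    - by apply: dcE; apply: sub; exact: subset_itv_oo_cc xa.
    - apply: continuous_in_subspaceT => x /set_mem xa.
      apply: differentiable_continuous; apply/derivable1_diffP.
      by have [] := dcE x (sub x xa).
    by rewrite normrM ler_wpM2r// dcL// sub.
  exists L => p s /St2 + /St2; rewrite /slab /mkset.
  have E : (s *: (e_t : ST) + p).1 = s + p.1 by exact: (congr1 (+%R^~ p.1) (mulr1 s)).
  rewrite E => p2 q2.
  suff : `|c (s + p.1) - c p.1| <= L * `|s| by rewrite -E.
  have [s0|s0] := leP p.1 (s + p.1).
    have := H _ _ p2 q2 s0.
    by have -> : s + p.1 - p.1 = s by ring.
  have := H _ _ q2 p2 (ltW s0).
  have -> : p.1 - (s + p.1) = - s by ring.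
  by rewrite normrN distrC.
Qed.

End lipschitz_supported.

(** * Integrals over the slab *)

Section monotone_integral.
Import HBNNSimple.
Context d (T : measurableType d) (R : realType) (mu : {measure set T -> \bar R}).

(* No measurability: the integral of a nonnegative function is a supremum over the
   simple functions below it. *)
Lemma ge0_le_integral_nonmeasurable (D : set T) (f g : T -> \bar R) :
  (forall x, D x -> (0 <= f x)%E) -> (forall x, D x -> (f x <= g x)%E) ->
  (\int[mu]_(x in D) f x <= \int[mu]_(x in D) g x)%E.
Proof.
move=> f0 fg.
have g0 x : D x -> (0 <= g x)%E by move=> Dx; apply: le_trans (fg x Dx); exact: f0.
rewrite !ge0_integralE//; apply: ge_ereal_sup => _ [h hf <-].
apply: le_ereal_sup_tmp; exists (sintegral mu h) => //; exists h => // x.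
apply: le_trans (hf x) _; rewrite /patch; case: ifP => // /set_mem; exact: fg.
Qed.

End monotone_integral.

Section slab_integral.
Context {R : realType} {m : nat}.
Local Notation leb := (@lebesgue_measure R).
Local Notation tupR := (m.-tuple (measurableTypeR R)).
Local Notation X := (measurableTypeR R * tupR)%type.
Local Notation mu := (@spacetime_measure R m).
Variable t2 : R.

Lemma ge0_slab_integral (f : X -> R) : measurable_fun setT f ->
  (forall x, 0 <= f x) -> (forall x, ~ 0 < x.1 < t2 -> f x = 0) ->
  (\int[leb]_(t in `]0%R, t2[) \int[lebesgue_tuple m]_x (f (t, x))%:E =
   \int[mu]_x (f x)%:E)%E.
Proof.
move=> mf f0 fout.
have mf' : measurable_fun setT (fun x => (f x)%:E) by exact/measurable_EFinP.
have f0' x : (0 <= (f x)%:E)%E by rewrite lee_fin.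
rewrite /spacetime_measure.
rewrite (@fubini_tonelli1 _ _ _ _ _ leb (lebesgue_tuple m) (fun x => (f x)%:E) mf' f0').
rewrite integral_mkcond; apply: eq_integral => t _; rewrite /patch.
case: ifPn => // tI; rewrite /fubini_F integral0_eq// => x _.
rewrite fout//= => H; move/negP : tI; apply.
by rewrite inE /= in_itv.
Qed.

(** Since d has zero integral, LH may be replaced by LH + d. Its positive part off N is measurable,
    vanishes off the slab and lies below E on it. Tonelli's theorem is applied to this positive
    part, and the final comparison with E is made inside the iterated integral. *)
Lemma slab_integral_le (LH d : X -> R) (N : set X) (E : X -> R) :
  measurable_fun setT LH -> (forall x, 0 <= LH x) ->
  mu.-integrable setT (EFin \o LH) -> null_divergence d ->
  measurable N -> mu N = 0%E -> (forall x, 0 <= E x) ->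
  (forall x, ~ N x -> 0 < x.1 < t2 -> LH x + d x <= E x) ->
  (forall x, ~ N x -> ~ 0 < x.1 < t2 -> LH x + d x <= 0) ->
  (\int[mu]_x (LH x)%:E <=
   \int[leb]_(t in `]0%R, t2[) \int[lebesgue_tuple m]_x (E (t, x))%:E)%E.
Proof.
move=> mLH LH0 iLH [md id ed] mN N0 E0 HE Hout.
(* The factor vanishing on N makes [k] at most [E] everywhere on the slab; the comparison of
   iterated integrals below allows no exceptional set. *)
pose k x := \1_(~` N) x * Num.max 0 (LH x + d x).
have mNC : measurable (~` N) by exact: measurableC.
have ms : measurable_fun setT (fun x => LH x + d x) by exact: measurable_funD.
have mk : measurable_fun setT k.
  apply: measurable_funM; first exact: measurable_indic.
  by apply: measurable_maxr => //; exact: measurable_cst.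
have max0 (r : R) : 0 <= Num.max 0 r by rewrite le_max lexx.
have k0 x : 0 <= k x by rewrite /k mulr_ge0// indicE; case: (_ \in _).
have kN x : N x -> k x = 0 by move=> Nx; rewrite /k indicE in_setC mem_set// mul0r.
have kNC x : ~ N x -> k x = Num.max 0 (LH x + d x).
  by move=> Nx; rewrite /k indicE in_setC memNset// mul1r.
have kout x : ~ 0 < x.1 < t2 -> k x = 0.
  move=> xt; have [Nx|Nx] := pselect (N x); first exact: kN.
  by rewrite kNC//; apply/max_idPl; exact: Hout.
have is_ : mu.-integrable setT (EFin \o (fun x => LH x + d x)).
  exact: (integrableD measurableT iLH id).
have ik : mu.-integrable setT (EFin \o k).
  apply: le_integrable is_ => //; first exact/measurable_EFinP.
  move=> x _ /=; rewrite lee_fin ger0_norm//.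
  have [Nx|Nx] := pselect (N x); first by rewrite kN.
  by rewrite kNC// ge_max normr_ge0 ler_norm.
have -> : (\int[mu]_x (LH x)%:E = \int[mu]_x (LH x + d x)%:E)%E.
  under [RHS]eq_integral do rewrite EFinD.
  by rewrite integralD// ed adde0.
apply: (@le_trans _ _ (\int[mu]_x (k x)%:E)%E).
  rewrite (negligible_integral mN measurableT is_ N0).
  rewrite (negligible_integral mN measurableT ik N0).
  have mD : measurable (setT `\` N) by exact: measurableD.
  apply: le_integral => //.
  - exact: (integrableS measurableT mD (@subsetT _ _) is_).
  - exact: (integrableS measurableT mD (@subsetT _ _) ik).
  - move=> x /set_mem [_ Nx] /=; rewrite lee_fin kNC//.
    by rewrite le_max lexx orbT.
rewrite -(ge0_slab_integral mk k0 kout).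
apply: ge0_le_integral_nonmeasurable => [t _|t tI].
  by apply: integral_ge0 => x _; rewrite lee_fin.
apply: ge0_le_integral_nonmeasurable => [x _|x _]; rewrite lee_fin//.
have [Nx|Nx] := pselect (N (t, x)); first by rewrite kN.
by rewrite kNC// ge_max E0 HE.
Qed.

End slab_integral.

(** * Weights, multipliers and coefficients *)

Section spacetime_derivatives.
Context {R : realType} {m : nat}.
Local Notation ST := (R * 'rV[R]_m)%type.
Local Notation X := (measurableTypeR R * m.-tuple (measurableTypeR R))%type.
Local Notation mu := (@spacetime_measure R m).

Lemma is_derive_sum_fun (u p : ST) I (r : seq I) (F : I -> ST -> R) (dF : I -> R) :
  (forall i, is_derive p u (F i) (dF i)) ->
  is_derive p u (fun q => \sum_(i <- r) F i q) (\sum_(i <- r) dF i).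
Proof.
move=> HF; elim: r => [|i r IH].
  rewrite big_nil; under eq_fun do rewrite big_nil.
  by have : is_derive p u (cst 0 : ST -> R) 0 by exact: is_derive_cst.
rewrite big_cons; under eq_fun do rewrite big_cons.
exact: (is_deriveD (HF i) IH).
Qed.

Lemma is_derive_mul_fun (u p : ST) (f g : ST -> R) (df dg : R) :
  is_derive p u f df -> is_derive p u g dg ->
  is_derive p u (fun q => f q * g q) (df * g p + f p * dg).
Proof.
move=> Hf Hg; have := is_deriveM Hf Hg.
have -> : f p *: dg + g p *: df = df * g p + f p * dg.
  by rewrite /GRing.scale /= addrC [g p * df]mulrC.
by [].
Qed.

Lemma is_derive_add_fun (u p : ST) (f g : ST -> R) (df dg : R) :
  is_derive p u f df -> is_derive p u g dg ->
  is_derive p u (fun q => f q + g q) (df + dg).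
Proof. by move=> Hf Hg; exact: (is_deriveD Hf Hg). Qed.

Lemma is_derive_scale_fun (u p : ST) (c : R) (f : ST -> R) (df : R) :
  is_derive p u f df -> is_derive p u (fun q => c * f q) (c * df).
Proof. by move=> Hf; exact: (is_deriveZ c Hf). Qed.

Lemma is_derive_time (p : ST) (c : R -> R) (dc : R) :
  is_derive p.1 1 c dc -> is_derive p e_t (fun q : ST => c q.1) dc.
Proof. by move=> /is_derive_line H; apply/is_derive_line; exact: H. Qed.

Lemma is_derive_time_v (p : ST) i (c : R -> R) :
  is_derive p (e_v i) (fun q : ST => c q.1) 0.
Proof.
apply/is_derive_line.
have -> : (fun s : R => c (s *: (e_v i : ST) + p).1) = cst (c p.1).
  by apply/funext => s /=; rewrite scaler0 add0r.
exact: is_derive_cst.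
Qed.

Lemma is_derive_coord (p u : ST) l :
  is_derive p u (fun q : ST => q.2 0 l) (u.2 0 l).
Proof.
apply/is_derive_line.
have -> : (fun s : R => (s *: u + p).2 0 l) = (fun s : R => u.2 0 l * s + p.2 0 l).
  by apply/funext => s; rewrite !mxE mulrC.
have H1 : is_derive (0 : R) 1 (fun s : R => u.2 0 l * s) (u.2 0 l * 1).
  exact: (is_deriveZ (u.2 0 l) (is_derive_id (0 : R) 1)).
have H2 : is_derive (0 : R) 1 (cst (p.2 0 l)) (0 : R) by exact: is_derive_cst.
by have := is_deriveD H1 H2; rewrite mulr1 addr0.
Qed.

Lemma is_derive_uniq (u p : ST) (f : ST -> R) (d1 d2 : R) :
  is_derive p u f d1 -> is_derive p u f d2 -> d1 = d2.
Proof. by move=> [_ <-] [_ <-]. Qed.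

Lemma null_divergence_scale c (d : X -> R) : null_divergence d ->
  null_divergence (fun x => c * d x).
Proof.
move=> [md id ed]; split.
- by apply: measurable_funM => //; exact: measurable_cst.
- exact: (integrableZl measurableT c id).
- under eq_integral do rewrite EFinM.
  by rewrite integralZl// ed mule0.
Qed.

Section power_weight.
Variables (b : R) (b0 : 0 < b).

Lemma powRN_le (c t : R) : 0 <= c -> 0 <= t -> (t + b) `^ (- c) <= b `^ (- c).
Proof.
move=> c0 t0; have tb : 0 < t + b by rewrite ltr_wpDl.
rewrite !powRN lef_pV2 ?posrE ?powR_gt0//.
apply: ge0_ler_powR => //; [|by rewrite nnegrE ltW|by rewrite lerDr].
by rewrite nnegrE ltW.
Qed.

Lemma is_derive_power_weight (c t : R) : 0 < t + b ->
  is_derive t 1 (fun t : R => (t + b) `^ c) (c * (t + b) `^ (c - 1)).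
Proof.
move=> tb; have := is_derive1_powR c tb.
move=> /is_derive_line H; apply/is_derive_line.
by under eq_fun do rewrite -addrA.
Qed.

Lemma measurable_power_weight (c : R) :
  measurable_fun [set: R] (fun t : R => (t + b) `^ c).
Proof.
have m1 : measurable_fun [set: R] (fun t : R => t + b).
  by apply: measurable_funD => //; exact: measurable_cst.
exact: (measurableT_comp (measurable_powR c) m1).
Qed.

(** Positivity of b keeps the weight and its derivative bounded on the slab. These bounds degenerate
    as b tends to 0, but they serve integrability only and do not reach the final constant. *)
Lemma lip_supported_power (S : set ST) (t2 c : R) f : compact S -> S `<=` slab t2 ->
  0 <= c -> lip_supported S e_t f ->
  lip_supported S e_t (fun p => (p.1 + b) `^ (- c) * f p).
Proof.
move=> cS St2 c0 lf.
apply: (@lip_supported_time_t R m S t2 St2 (fun t => (t + b) `^ (- c))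
   (fun t => - c * (t + b) `^ (- c - 1)) (c * b `^ (- (c + 1)))) => //.
- exact: measurable_power_weight.
- exists (b `^ (- c)) => t /andP[t0 _]; rewrite ger0_norm ?powR_ge0//.
  by rewrite powRN_le// ltW.
- move=> t /andP[t0 _]; apply: is_derive_power_weight.
  by rewrite ltr_wpDl// ltW.
- move=> t /andP[t0 _]; rewrite normrM normrN (ger0_norm c0) ler_wpM2l//.
  rewrite ger0_norm ?powR_ge0// -opprD.
  by apply: powRN_le; rewrite ?addr_ge0 ?(ltW t0).
Qed.

Lemma power_weight_bounded (t2 c : R) : 0 <= c ->
  exists B, forall t, 0 < t < t2 -> `|(t + b) `^ (- c)| <= B.
Proof.
move=> c0; exists (b `^ (- c)) => t /andP[t0 _].
by rewrite ger0_norm ?powR_ge0// powRN_le// ltW.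
Qed.

End power_weight.

Section multiplier.
Variables (S : set ST) (cS : compact S) (t2 : R) (St2 : S `<=` slab t2).
Variables (tau f f' : ST -> R) (c1 c2 : R -> R) (c3 : 'I_m -> R -> R).
Hypotheses (stau : smooth_supported S tau) (sf : smooth_supported S f)
  (sf' : smooth_supported S f').
Hypotheses (mc1 : measurable_fun setT c1) (mc2 : measurable_fun setT c2)
  (mc3 : forall l, measurable_fun setT (c3 l)).
Let bounded_on_slab (c : R -> R) := exists B, forall t, 0 < t < t2 -> `|c t| <= B.
Hypotheses (bc1 : bounded_on_slab c1) (bc2 : bounded_on_slab c2)
  (bc3 : forall l, bounded_on_slab (c3 l)).

(** One real component of the multiplier of div (A grad h): f is a component of h, tau its time
    derivative, and f' the other component, coupled to f by the drift i (phi . v). *)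
Definition flux_multiplier p :=
  c1 p.1 * tau p + c2 p.1 * f p + \sum_l c3 l p.1 * (p.2 0 l * f' p).

Lemma lip_supported_flux_multiplier i :
  lip_supported S (e_v i) flux_multiplier.
Proof.
have lt := smooth_supported_lip cS (e_v i) stau.
have l1 := smooth_supported_lip cS (e_v i) sf.
have l2 := smooth_supported_lip cS (e_v i) sf'.
apply: lip_supportedD.
  apply: lip_supportedD.
    exact: (lip_supported_time_v St2 mc1 bc1 lt).
  exact: (lip_supported_time_v St2 mc2 bc2 l1).
apply: lip_supported_sum => l.
by apply: (lip_supported_time_v St2 (mc3 l) (bc3 l)); exact: lip_supported_coord.
Qed.

Lemma is_derive_flux_multiplier i p :
  is_derive p (e_v i) flux_multiplier
    (c1 p.1 * 'D_(e_v i) tau p + c2 p.1 * 'D_(e_v i) f p +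
     (c3 i p.1 * f' p + (\sum_l c3 l p.1 * p.2 0 l) * 'D_(e_v i) f' p)).
Proof.
have D (g : ST -> R) : smooth_supported S g -> is_derive p (e_v i) g ('D_(e_v i) g p).
  by move=> sg; apply: derivableP; exact: (@smooth_supported_derivable R m S g (e_v i) p sg).
have mulc (c : R -> R) (g : ST -> R) dg : is_derive p (e_v i) g dg ->
    is_derive p (e_v i) (fun q => c q.1 * g q) (c p.1 * dg).
  move=> Hg; have := is_derive_mul_fun (is_derive_time_v p i c) Hg.
  by rewrite mul0r add0r.
have -> : c3 i p.1 * f' p + (\sum_l c3 l p.1 * p.2 0 l) * 'D_(e_v i) f' p =
    \sum_l c3 l p.1 * ((l == i)%:R * f' p + p.2 0 l * 'D_(e_v i) f' p).
  have sE : \sum_l c3 l p.1 * ((l == i)%:R * f' p) = c3 i p.1 * f' p.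
    rewrite (bigD1 i)//= eqxx mul1r big1 ?addr0// => l li.
    by rewrite (negbTE li) mul0r mulr0.
  under [RHS]eq_bigr do rewrite mulrDr.
  rewrite big_split /= sE mulr_suml; congr (_ + _).
  by apply: eq_bigr => l _; rewrite mulrA.
apply: is_derive_add_fun.
  by apply: is_derive_add_fun; apply: mulc; exact: D.
apply: is_derive_sum_fun => l; apply: mulc.
have := is_derive_mul_fun (is_derive_coord p (e_v i) l) (D _ sf').
by rewrite /e_v /= mxE eqxx /=.
Qed.

End multiplier.

Section coefficients.
Variables (lam T : R) (A : ST -> 'M[R]_m).
Hypothesis lam1 : 1 < lam.
Hypothesis hA : elliptic_lipschitz lam T A.

Lemma coefficient_sym p i j : slab T p -> A p i j = A p j i.
Proof. by move=> sp; have [H _ _ _] := hA; exact: H. Qed.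

Lemma coefficient_elliptic p (x : 'I_m -> R) : slab T p ->
  lam^-1 * \sum_i x i ^+ 2 <= \sum_i \sum_j A p i j * x i * x j
    <= lam * \sum_i x i ^+ 2.
Proof.
move=> sp; have [_ _ H _] := hA; have := H p sp (\row_i x i).
have -> : \sum_i (\row_i x i) 0 i ^+ 2 = \sum_i x i ^+ 2.
  by apply: eq_bigr => i _; rewrite mxE.
have -> : \sum_i \sum_j A p i j * (\row_i x i) 0 i * (\row_i x i) 0 j =
    \sum_i \sum_j A p i j * x i * x j.
  by apply: eq_bigr => i _; apply: eq_bigr => j _; rewrite !mxE.
by [].
Qed.

(** Polarisation: the form is nonnegative at e_i + e_j and at e_i - e_j, so 2 |a_ij| <= a_ii + a_jj
    <= 2 lam. *)
Lemma coefficient_bound p i j : slab T p -> `|A p i j| <= lam.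
Proof.
move=> sp; have lam1' := lam1.
have l0 : 0 < lam by lra.
pose q (x : 'I_m -> R) := \sum_k \sum_l A p k l * x k * x l.
have qub x : 0 <= q x <= lam * \sum_k x k ^+ 2.
  have /andP[q1 ->] := coefficient_elliptic x sp; rewrite andbT; apply: le_trans q1.
  by rewrite mulr_ge0 ?invr_ge0 ?(ltW l0)// sumr_ge0// => k _; exact: sqr_ge0.
pose dl (k l : 'I_m) : R := (l == k)%:R.
have sumd (k : 'I_m) (F : 'I_m -> R) : \sum_l F l * dl k l = F k.
  rewrite (bigD1 k)//= /dl eqxx mulr1 big1 ?addr0// => l /negbTE ->.
  by rewrite mulr0.
have sq (k : 'I_m) : \sum_l dl k l ^+ 2 = 1.
  rewrite (eq_bigr (fun l => 1 * dl k l)) ?sumd// => l _.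
  by rewrite /dl mul1r; case: (l == k); rewrite ?expr1n ?expr0n.
have qd c c' k k' : q (fun l => c * dl k l + c' * dl k' l) =
    c ^+ 2 * A p k k + c * c' * (A p k k' + A p k' k) + c' ^+ 2 * A p k' k'.
  rewrite /q.
  have E1 r : \sum_l A p r l * (c * dl k r + c' * dl k' r) * (c * dl k l + c' * dl k' l) =
      (c * A p r k + c' * A p r k') * c * dl k r + (c * A p r k + c' * A p r k') * c' * dl k' r.
    transitivity ((c * dl k r + c' * dl k' r) *
        (c * \sum_l A p r l * dl k l + c' * \sum_l A p r l * dl k' l)).
      rewrite !mulr_sumr -big_split /= mulr_sumr; apply: eq_bigr => l _; ring.
    by rewrite !sumd; ring.
  under eq_bigr do rewrite E1.
  by rewrite big_split /= !sumd; ring.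
have diag k : 0 <= A p k k <= lam.
  have := qub (fun l => 1 * dl k l + 0 * dl k l).
  rewrite qd (eq_bigr (fun l => dl k l ^+ 2)) ?sq; last first.
    by move=> l _; congr (_ ^+ 2); ring.
  by rewrite expr1n expr0n /= !mul0r !mulr0 !mul0r !addr0 mul1r mulr1.
have [<-|ij] := eqVneq i j.
  by have /andP[a1 a2] := diag i; rewrite ger0_norm.
have /andP[p1 _] := qub (fun l => 1 * dl i l + 1 * dl j l).
have /andP[p2 _] := qub (fun l => 1 * dl i l + (-1) * dl j l).
rewrite qd (coefficient_sym j i sp) in p1; rewrite qd (coefficient_sym j i sp) in p2.
have /andP[_ d1] := diag i; have /andP[_ d2] := diag j.
by rewrite ler_norml; apply/andP; split; lra.
Qed.

Lemma coefficient_lipschitz i j : exists2 L, 0 <= L &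
  forall p q, slab T p -> slab T q -> `|A p i j - A q i j| <= L * `|p - q|.
Proof.
have [_ H _ _] := hA; have [M [_ HM]] := H i j.
exists (`|M| + 1); first by rewrite addr_ge0.
move=> p q sp sq; have ML : M < `|M| + 1 by rewrite (le_lt_trans (ler_norm M))// ltrDl.
exact: (HM _ ML (p, q) (conj sp sq)).
Qed.

Lemma coefficient_continuous i j p : slab T p -> {for p, continuous (fun q => A q i j)}.
Proof.
move=> sp; have [L L0 AL] := coefficient_lipschitz i j.
have nT : \forall q \near p, slab T q.
  have pT : p.1 \in `]0, T[ by rewrite in_itv.
  have n1 : \forall t \near p.1, t \in `]0, T[ by exact: near_in_itvoo.
  have c1 : q.1 @[q --> p] --> p.1 by exact: cvg_fst.
  near=> q; have : q.1 \in `]0, T[ by near: q; exact: (c1 _ n1).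
  by rewrite in_itv.
apply/cvgrPdist_le => e e0; near=> q.
have sq : slab T q by near: q.
apply: le_trans (AL _ _ sp sq) _.
apply: (@le_trans _ _ ((L + 1) * `|p - q|)).
  by rewrite ler_wpM2r// lerDl.
rewrite mulrC -ler_pdivlMr ?ltr_wpDl//.
near: q; have cq : q @[q --> p] --> p by exact: cvg_id.
move/cvgrPdist_le : cq; apply.
by rewrite divr_gt0// ltr_wpDl.
Unshelve. all: by end_near. Qed.

Section supported.
Variables (S : set ST) (cS : compact S) (ST0 : S `<=` slab T).

(** Outside the slab A is arbitrary, but a point off S has a neighbourhood on which the product is
    identically 0. *)
Lemma coefficient_mul_continuous i j (f : ST -> R) : continuous f ->
  (forall p, ~ S p -> f p = 0) -> continuous (fun p => A p i j * f p).
Proof.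
move=> cf f0 p; have [Sp|Sp] := pselect (S p).
  by apply: cvgM; [exact: (coefficient_continuous (ST0 Sp))|exact: cf].
have : nbhs p (~` S).
  by apply: open_nbhs_nbhs; split => //; apply: closed_openC; exact: compact_support_closed.
move=> Sn; have E : A p i j * f p = 0 by rewrite f0// mulr0.
rewrite /continuous_at E; apply: cvg_near_cst; near=> q.
rewrite f0 ?mulr0//; near: q; exact: Sn.
Unshelve. all: by end_near. Qed.

Lemma lip_supported_coefficient u i j f : continuous f -> lip_supported S u f ->
  lip_supported S u (fun p => A p i j * f p).
Proof.
move=> cf lf; have [L L0 AL] := coefficient_lipschitz i j.
apply: (lip_supported_mul (k := fun p => A p i j)) => //.
- apply: measurable_continuous_point; apply: coefficient_mul_continuous => //.
  by have [_ + _ _] := lf.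
- by exists lam => p /ST0; exact: coefficient_bound.
- exists (L * `|u|) => p s /ST0 sp /ST0 sq.
  apply: le_trans (AL _ _ sq sp) _.
  by rewrite addrK normrZ mulrAC -mulrA.
Qed.

End supported.
End coefficients.
End spacetime_derivatives.

(** * Measurability of the frequency *)

Section matrix_exponential.
Context {R : realType} {n : nat}.
Implicit Types M : 'M[R]_n.

Lemma mx_entry_le_norm M i j : `|M i j| <= `|M|.
Proof.
by rewrite [leRHS]/Num.norm /= mx_normrE; apply/bigmax_geP; right; exists (i, j).
Qed.

Lemma mx_norm_le M (c : R) : 0 <= c -> (forall i j, `|M i j| <= c) -> `|M| <= c.
Proof.
move=> c0 Mc; rewrite [leLHS]/Num.norm /= mx_normrE; apply/bigmax_leP.
by split => // -[i j] _; exact: Mc.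
Qed.

(** The norm is the largest entry in absolute value, so each matrix product costs a factor n. *)
Lemma mx_norm_exp M k : `|M ^+ k| <= (n%:R * `|M|) ^+ k.
Proof.
apply: mx_norm_le => [|i j]; first by rewrite exprn_ge0// mulr_ge0.
elim: k i j => [|k IH] i j.
  by rewrite !expr0 mxE; case: (i == j); rewrite /= ?normr1 ?normr0.
rewrite exprS (_ : M * M ^+ k = M *m M ^+ k)// mxE.
rewrite (le_trans (ler_norm_sum _ _ _))//.
rewrite (@le_trans _ _ (\sum_(l < n) `|M| * (n%:R * `|M|) ^+ k))//.
  apply: ler_sum => l _; rewrite normrM; apply: ler_pM => //.
  exact: mx_entry_le_norm.
by rewrite sumr_const card_ord -[leLHS]mulr_natl mulrA -exprS.
Qed.

(** Every entry is dominated by the scalar exponential series of n |M|. The matrix series then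
    converges in norm, which identifies the limit defining [expmx] entry by entry. *)
Lemma cvg_expmx_entry M i j :
  (\sum_(0 <= k < N) k`!%:R^-1 * (M ^+ k) i j) @[N --> \oo] --> expmx M i j.
Proof.
pose u (k : nat) : 'M[R]_n := k`!%:R^-1 *: M ^+ k.
have seriesE N a c : series u N a c = series (fun k => u k a c) N.
  by rewrite /series /= summxE.
have ce a c : cvgn (series (fun k => u k a c)).
  apply: normed_cvg.
  have := @series_le_cvg R (fun k => `|u k a c|) (exp_coeff (n%:R * `|M|)); apply.
  - by move=> k; exact: normr_ge0.
  - by move=> k; apply: exp_coeff_ge0; rewrite mulr_ge0.
  - move=> k; rewrite /u mxE normrM ger0_norm ?invr_ge0// /exp_coeff mulrC.
    rewrite ler_wpM2r ?invr_ge0//.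
    by apply: le_trans (mx_norm_exp M k); exact: mx_entry_le_norm.
  - exact: is_cvg_series_exp_coeff.
pose L : 'M[R]_n := \matrix_(a, c) limn (series (fun k => u k a c)).
have cu : series u @ \oo --> L.
  apply/cvgrPdist_le => e e0.
  have : \forall N \near \oo, forall a c, `|L a c - series u N a c| <= e.
    apply: filter_forall => a; apply: filter_forall => c.
    have := ce a c; move=> /cvgrPdist_le /(_ e e0).
    by apply: filterS => N; rewrite seriesE mxE.
  apply: filterS => N H; apply: mx_norm_le => [|a c]; first exact: ltW.
  by rewrite !mxE; have := H a c; rewrite !mxE.
have -> : expmx M i j = limn (series (fun k => u k i j)).
  rewrite /expmx -/u (cvg_lim _ cu) ?mxE//; exact: norm_hausdorff.
have := ce i j; apply: cvg_trans; apply: near_eq_cvg; near=> N.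
by rewrite /series /=; apply: eq_bigr => k _; rewrite /u mxE.
Unshelve. all: by end_near. Qed.

Lemma measurable_expmx_entry M i j :
  measurable_fun [set: measurableTypeR R] (fun t => expmx (- t *: M) i j).
Proof.
have mk k a c : measurable_fun [set: measurableTypeR R]
    (fun t : R => ((- t *: M) ^+ k) a c).
  elim: k a c => [|k IH] a c.
    by under eq_fun do rewrite expr0; exact: measurable_cst.
  have -> : (fun t : R => ((- t *: M) ^+ k.+1) a c) =
      (fun t : R => \sum_l (- t * M a l) * ((- t *: M) ^+ k) l c).
    apply/funext => t; rewrite exprS.
    rewrite -[(- t *: M) * _]/((- t *: M) *m (- t *: M) ^+ k) mxE.
    by apply: eq_bigr => l _; rewrite mxE.
  apply: measurable_sum => l; apply: measurable_funM; last exact: IH.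
  by apply: measurable_funM; [exact: oppr_measurable|exact: measurable_cst].
pose h (N : nat) (t : measurableTypeR R) : R :=
  \sum_(0 <= k < N) k`!%:R^-1 * ((- t *: M) ^+ k) i j.
have mh N : measurable_fun [set: measurableTypeR R] (h N).
  apply: measurable_sum => k; apply: measurable_funM; last exact: mk.
  exact: measurable_cst.
have hc (t : measurableTypeR R) : [set: measurableTypeR R] t ->
    h ^~ t @ \oo --> expmx (- t *: M) i j.
  by move=> _; exact: cvg_expmx_entry.
exact: (measurable_fun_cvg mh hc).
Qed.

(** The exponential is a pointwise limit of polynomials in t. Measurability is what the spatial
    fluxes ask of the frequency, besides boundedness. *)
Lemma measurable_frequency m (B1 : 'M[R]_(n, m)) (B2 : 'M[R]_n) (rho : 'cV[R]_n) i :
  measurable_fun [set: measurableTypeR R] (fun t => frequency B1 B2 rho t i 0).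
Proof.
rewrite /frequency; under eq_fun do rewrite mxE.
apply: measurable_sum => l; apply: measurable_funM; last exact: measurable_cst.
under eq_fun do rewrite mxE.
apply: measurable_sum => k; apply: measurable_funM; first exact: measurable_cst.
exact: measurable_expmx_entry.
Qed.

End matrix_exponential.

(** * The pointwise inequality *)

Section pointwise_inequality.
Context {R : realType} {m : nat}.
Implicit Types (x y g p : 'I_m -> R).

Lemma sqr_sum_normr_le x : (\sum_i `|x i|) ^+ 2 <= m%:R * \sum_i x i ^+ 2.
Proof.
rewrite expr2 mulr_suml; under eq_bigr do rewrite mulr_sumr.
rewrite (@le_trans _ _ (\sum_i \sum_j (x i ^+ 2 / 2 + x j ^+ 2 / 2)))//.
  apply: ler_sum => i _; apply: ler_sum => j _.
  rewrite -(real_normK (num_real (x i))) -(real_normK (num_real (x j))).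
  by have := sqr_ge0 (`|x i| - `|x j|); nra.
under eq_bigr do rewrite big_split /= sumr_const card_ord -(mulr_natl _ m) -mulr_suml.
rewrite big_split /= sumr_const card_ord -(mulr_natl _ m) -mulr_sumr -mulr_suml.
by rewrite le_eqVlt; apply/orP; left; apply/eqP; field.
Qed.

Variables (lam : R) (a : 'I_m -> 'I_m -> R).
Hypothesis a_sym : forall i j, a i j = a j i.
Hypothesis a_bound : forall i j, `|a i j| <= lam.
Hypothesis a_coercive : forall x,
  lam^-1 * \sum_i x i ^+ 2 <= \sum_i \sum_j a i j * x i * x j.

Let W g i := \sum_j a i j * g j.

Lemma sum_form_sym x y : \sum_i x i * W y i = \sum_i y i * W x i.
Proof.
rewrite /W; under eq_bigr do rewrite mulr_sumr.
under [RHS]eq_bigr do rewrite mulr_sumr.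
rewrite exchange_big; apply: eq_bigr => i _; apply: eq_bigr => j _.
by rewrite a_sym; ring.
Qed.

Lemma sum_form_bound p g :
  `|\sum_i p i * W g i| <= lam * (\sum_i `|p i|) * (\sum_i `|g i|).
Proof.
rewrite (le_trans (ler_norm_sum _ _ _))// -mulrA mulr_suml mulr_sumr.
apply: ler_sum => i _; rewrite normrM mulrCA ler_wpM2l// mulr_sumr.
rewrite (le_trans (ler_norm_sum _ _ _))//; apply: ler_sum => j _.
by rewrite normrM ler_wpM2r.
Qed.

Variables (al kap s sg : R).
Hypothesis m0 : (0 < m)%N.
Hypothesis lam1 : 1 < lam.
Hypothesis s0 : 0 < s.
Hypothesis s_small : s * (8 * m%:R * lam ^+ 2) <= 1.
Hypothesis sg0 : 0 <= sg.
Hypothesis al2 : 2 <= al.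
Hypothesis alk : 2 * `|kap| <= al.
(** Values at one point: [h1], [h2] are the real and imaginary parts of h, [t1], [t2] their time
    derivatives, [g1], [g2] their v-gradients, [et1], [et2] the v-gradients of the time derivatives,
    [D1 i], [D2 i] the v_i-derivatives of the i-th component of A grad h. Further, [ph] is the
    frequency, [th] its product with v, [sg] = s^(-2 al), and thus [om] = s^(1 - 2 al). *)
Variables (h1 h2 t1 t2 th : R) (g1 g2 et1 et2 D1 D2 ph : 'I_m -> R).
Hypothesis ph_small :
  s ^+ 3 * (\sum_i ph i ^+ 2) * (512 * m%:R ^+ 2 * lam ^+ 5) <= al.

Let om := sg * s.
Let mu := 1 / (8 * lam ^+ 2).
Let G := \sum_i (g1 i ^+ 2 + g2 i ^+ 2).
Let hh := h1 ^+ 2 + h2 ^+ 2.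
Let F i j := g1 i * g1 j + g2 i * g2 j.

(** The left side is the commutator of the drift with A. Young's inequality with weight [K] = 8 m
    lam^2 is tuned so that the gradient part is G/(8 lam); the other part is then 8 m^2 lam^3 s^2
    |ph|^2 hh, and [ph_small], with its constant 512 = 8 * 64, is what puts it below the stated
    share of al/s hh. *)
Lemma cross_frequency_bound :
  2 * s * (h1 * (\sum_i ph i * W g2 i) - h2 * (\sum_i ph i * W g1 i)) <=
  G / (8 * lam) + al / s * hh / (64 * lam ^+ 2).
Proof.
have lam1' := lam1; have l0 : 0 < lam by lra.
have M0 : 0 < m%:R :> R by rewrite ltr0n.
set p := \sum_i `|ph i|; set q1 := \sum_i `|g1 i|; set q2 := \sum_i `|g2 i|.
have p0 : 0 <= p by exact: sumr_ge0.
have q10 : 0 <= q1 by exact: sumr_ge0.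
have q20 : 0 <= q2 by exact: sumr_ge0.
have H1 := sum_form_bound ph g1; have H2 := sum_form_bound ph g2.
rewrite -/p -/q1 -/q2 in H1 H2.
have Hx1 : h1 * (\sum_i ph i * W g2 i) <= `|h1| * (lam * p * q2).
  by rewrite (le_trans (ler_norm _))// normrM ler_wpM2l.
have Hx2 : - (h2 * (\sum_i ph i * W g1 i)) <= `|h2| * (lam * p * q1).
  by rewrite -mulrN (le_trans (ler_norm _))// normrM normrN ler_wpM2l.
have dl0 : 0 < 8 * m%:R * lam ^+ 2 by rewrite !mulr_gt0// exprn_gt0.
set K := 8 * m%:R * lam ^+ 2 in dl0.
have amgm (x q : R) : 2 * s * (lam * p * q * x) <=
    lam * (K * (s * p * x) ^+ 2 + K^-1 * q ^+ 2).
  rewrite -subr_ge0.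
  have -> : lam * (K * (s * p * x) ^+ 2 + K^-1 * q ^+ 2) - 2 * s * (lam * p * q * x) =
     lam * K^-1 * (K * (s * p * x) - q) ^+ 2 by field; rewrite ?(gt_eqF dl0).
  apply: mulr_ge0; last exact: sqr_ge0.
  by apply: mulr_ge0; [exact: ltW|rewrite invr_ge0; exact: ltW].
have A1 := amgm `|h1| q2; have A2 := amgm `|h2| q1.
have Q1 : q1 ^+ 2 + q2 ^+ 2 <= m%:R * G.
  by rewrite /G big_split /= mulrDr lerD// sqr_sum_normr_le.
have P1 : p ^+ 2 <= m%:R * \sum_i ph i ^+ 2 by exact: sqr_sum_normr_le.
have hhE : `|h1| ^+ 2 + `|h2| ^+ 2 = hh by rewrite /hh !real_normK ?num_real.
have hh0 : 0 <= hh by rewrite addr_ge0 ?sqr_ge0.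
have step1 : 2 * s * (h1 * (\sum_i ph i * W g2 i) - h2 * (\sum_i ph i * W g1 i)) <=
    lam * (K * (s ^+ 2 * p ^+ 2) * hh + K^-1 * (q1 ^+ 2 + q2 ^+ 2)).
  rewrite -hhE.
  apply: (@le_trans _ _ (2 * s * (lam * p * q2 * `|h1|) + 2 * s * (lam * p * q1 * `|h2|))).
    rewrite -mulrDr; apply: ler_wpM2l; first by rewrite mulr_ge0// ltW.
    move: Hx1 Hx2; set Y1 := \sum_i _; set Y2 := \sum_i _.
    rewrite -[h1 * Y1 - _]/(h1 * Y1 + - (h2 * Y2)) => Hx1 Hx2.
    by apply: lerD; rewrite [leRHS]mulrC.
  rewrite (le_trans (lerD A1 A2))//.
  by rewrite le_eqVlt; apply/orP; left; apply/eqP; ring.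
apply: (le_trans step1); rewrite mulrDr addrC lerD//.
  apply: (@le_trans _ _ (lam * (K^-1 * (m%:R * G)))).
    by apply: ler_wpM2l; [exact: ltW|apply: ler_wpM2l => //; rewrite invr_ge0; exact: ltW].
  rewrite le_eqVlt; apply/orP; left; apply/eqP; rewrite /K; field.
  by rewrite ?(gt_eqF l0) ?(gt_eqF s0) ?(gt_eqF M0).
apply: (@le_trans _ _ (lam * (K * (s ^+ 2 * (m%:R * \sum_i ph i ^+ 2)) * hh))).
  apply: ler_wpM2l; first exact: ltW.
  apply: ler_wpM2r => //; apply: ler_wpM2l; first exact: ltW.
  by apply: ler_wpM2l => //; rewrite exprn_ge0// ltW.
rewrite mulrA [leRHS]mulrAC ler_wpM2r//.
rewrite -subr_ge0; move: ph_small; rewrite -subr_ge0.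
set Ph := \sum_i ph i ^+ 2 => H.
have -> : al / s / (64 * lam ^+ 2) - lam * (K * (s ^+ 2 * (m%:R * Ph))) =
  (al - s ^+ 3 * Ph * (512 * m%:R ^+ 2 * lam ^+ 5)) / (s * (64 * lam ^+ 2)).
  by rewrite /K; field; rewrite ?(gt_eqF l0) ?(gt_eqF s0) ?(gt_eqF M0).
apply: divr_ge0 => //; apply: mulr_ge0; first exact: ltW.
by apply: mulr_ge0 => //; rewrite exprn_ge0// ltW.
Qed.

Lemma sum_normF_le : \sum_i \sum_j `|F i j| <= m%:R * G.
Proof.
apply: (@le_trans _ _ ((\sum_i `|g1 i|) ^+ 2 + (\sum_i `|g2 i|) ^+ 2)).
  rewrite !expr2 !mulr_suml -big_split /=; apply: ler_sum => i _.
  rewrite !mulr_sumr -big_split /=; apply: ler_sum => j _.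
  by rewrite (le_trans (ler_normD _ _))// !normrM.
by rewrite /G big_split /= mulrDr lerD// sqr_sum_normr_le.
Qed.

(** Gradient budget: (1 - 2 mu) Q >= (3/4) G/lam, of which the frequency and the time derivative of
    A take at most 1/8 each. Zero-order budget: with v = lam^(-2), the term 2 mu al/s equals al v/(4
    s), while the terms in mu and in kap cost at most al v/(16 s) each. What remains dominates the
    left-hand density. *)
Lemma absorption (Q H SF : R) : G / lam <= Q ->
  2 * s * H <= G / (8 * lam) + al / s * hh / (64 * lam ^+ 2) ->
  SF <= m%:R * G ->
  (G + al / s * hh) / (32 * lam ^+ 2) + (2 * mu - 1) * Q + 2 * s * H + lam * s * SF <=
  (2 * mu * al / s - mu / s + kap * (1 - 2 * mu)) * hh.
Proof.
move=> QG HG SFG.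
have lam1' := lam1; have al2' := al2; have alk' := alk.
have l0 : 0 < lam by lra.
have M0 : 1 <= m%:R :> R by rewrite ler1n.
have ll : 1 < lam ^+ 2 by rewrite expr2; nra.
have ll0 : 0 < lam ^+ 2 by lra.
have G0 : 0 <= G by apply: sumr_ge0 => i _; rewrite addr_ge0 ?sqr_ge0.
have hh0 : 0 <= hh by rewrite addr_ge0 ?sqr_ge0.
set v := (lam ^+ 2)^-1; set w := lam^-1.
have v0 : 0 < v by rewrite invr_gt0.
have w0 : 0 < w by rewrite invr_gt0.
have v1 : v < 1 by rewrite invf_lt1.
have vw : v <= w.
  by rewrite lef_pV2 ?posrE// expr2 ler_peMl// ltW.
have muE : mu = v / 8 by rewrite /mu /v; field; rewrite ?(gt_eqF l0) ?(gt_eqF s0).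
have sE : lam * s * SF <= w / 8 * G.
  apply: (@le_trans _ _ (lam * s * (m%:R * G))).
    by apply: ler_wpM2l => //; apply: mulr_ge0; exact: ltW.
  rewrite mulrA ler_wpM2r//.
  have -> : lam * s * m%:R = s * (8 * m%:R * lam ^+ 2) * (w / 8).
    by rewrite /w; field; rewrite ?(gt_eqF l0) ?(gt_eqF s0).
  rewrite -[leRHS]mul1r; apply: ler_wpM2r; last exact: s_small.
  by apply: divr_ge0 => //; exact: ltW.
have QE : (2 * mu - 1) * Q <= - (3 / 4 * (w * G)).
  have -> : w * G = G / lam by rewrite mulrC.
  have : 0 <= G / lam by apply: divr_ge0 => //; exact: ltW.
  rewrite muE; nra.
have GE : G / (8 * lam) = w / 8 * G by rewrite /w; field; rewrite ?(gt_eqF l0) ?(gt_eqF s0).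
have G2E : (G + al / s * hh) / (32 * lam ^+ 2) = v / 32 * G + v / 32 * (al / s * hh).
  by rewrite /v; field; rewrite ?(gt_eqF l0) ?(gt_eqF s0).
have h2E : al / s * hh / (64 * lam ^+ 2) = v / 64 * (al / s * hh).
  by rewrite /v; field; rewrite ?(gt_eqF l0) ?(gt_eqF s0).
rewrite GE h2E in HG; rewrite G2E.
have vwG : v * G <= w * G by rewrite ler_wpM2r.
have wG : 0 <= w * G by apply: mulr_ge0 => //; exact: ltW.
have ks : `|kap| * s <= al * v / 16.
  have s8 : s <= v / 8.
    have e : s * (8 * m%:R * lam ^+ 2) * (v / 8) = s * m%:R.
      by rewrite /v; field; rewrite ?(gt_eqF l0) ?(gt_eqF s0).
    have : s * m%:R <= v / 8.
      rewrite -e -[leRHS]mul1r; apply: ler_wpM2r; last exact: s_small.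
      by apply: divr_ge0 => //; exact: ltW.
    by apply: le_trans; rewrite ler_peMr// ltW.
  have k0 : 0 <= `|kap| by [].
  have : `|kap| * s <= al / 2 * (v / 8).
    by apply: ler_pM => //; [exact: ltW|lra].
  lra.
have kap_le : - (al * v / 16) <= kap * s * (1 - 2 * mu).
  have : - `|kap * s * (1 - 2 * mu)| <= kap * s * (1 - 2 * mu) by rewrite lerNnormlW.
  apply: le_trans; rewrite lerN2 !normrM (gtr0_norm s0).
  apply: le_trans ks; apply: ler_piMr; first by apply: mulr_ge0 => //; exact: ltW.
  by rewrite ger0_norm muE; lra.
have RE : (2 * mu * al / s - mu / s + kap * (1 - 2 * mu)) * hh =
    (2 * mu * al - mu + kap * s * (1 - 2 * mu)) * (hh / s).
  by field; rewrite ?(gt_eqF l0) ?(gt_eqF s0).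
have ZE : al / s * hh = al * (hh / s) by field; rewrite ?(gt_eqF l0) ?(gt_eqF s0).
rewrite RE ZE in HG *.
have hs0 : 0 <= hh / s by apply: divr_ge0 => //; exact: ltW.
have key : (v / 32 + v / 64) * al <= 2 * mu * al - mu + kap * s * (1 - 2 * mu).
  by rewrite muE in kap_le *; nra.
have := ler_wpM2r hs0 key; lra.
Qed.

(** [P1], [P2] are the parts of the operator applied to h. [psi1], [psi2] are those of s^al X g for
    g = s^(-al) h, so that P - psi is s^al Y g. *)
Let P1 := t1 - th * h2 + \sum_i D1 i - kap * h1.
Let P2 := t2 + th * h1 + \sum_i D2 i - kap * h2.
Let psi1 := t1 - al / s * h1 - th * h2.
Let psi2 := t2 - al / s * h2 + th * h1.

(** [e i j] stands for the time derivative of a_ij om F_ij taken as a whole. The subtracted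
    expression is the product rule without the term in the derivative of a_ij, which is never
    isolated and enters through the bound only. *)
Variable e : 'I_m -> 'I_m -> R.
Hypothesis e_bound : forall i j,
  `|e i j - a i j * ((1 - 2 * al) * sg * F i j +
     om * (et1 i * g1 j + g1 i * et1 j + (et2 i * g2 j + g2 i * et2 j)))|
  <= lam * `|om * F i j|.

(** The second summand on the left is the total divergence with all derivatives expanded. The terms
    of size al in Q cancel: -2 om al/s from the multiplier against -(1 - 2 al) sg from the time
    flux, which with 2 mu sg leaves (2 mu - 1) sg Q. The mixed derivatives cancel likewise. On the
    right, 1 accounts for the commutator and mu for the test against h. *)
Lemma carleman_pointwise :
  (sg * G + al * (sg / s) * hh) / (32 * lam ^+ 2) +
  (\sum_i (((2 * om * (et1 i - al / s * g1 i - (ph i * h2 + th * g2 i)) + 2 * mu * sg * g1 i)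
              * W g1 i + (2 * om * psi1 + 2 * mu * sg * h1) * D1 i) +
           ((2 * om * (et2 i - al / s * g2 i + (ph i * h1 + th * g1 i)) + 2 * mu * sg * g2 i)
              * W g2 i + (2 * om * psi2 + 2 * mu * sg * h2) * D2 i)) +
   (- \sum_i \sum_j e i j +
    (((al + mu) * (- (2 * al) * (sg / s)) - kap * ((1 - 2 * al) * sg)) * hh +
     ((al + mu) * sg - kap * om) * (2 * (h1 * t1 + h2 * t2))))) <=
  (1 + mu) * (om * (P1 ^+ 2 + P2 ^+ 2)).
Proof.
have lam1' := lam1; have l0 : 0 < lam by lra.
have om0 : 0 <= om by apply: mulr_ge0 => //; exact: ltW.
have mu0 : 0 <= mu.
  by apply: divr_ge0 => //; apply: mulr_ge0 => //; rewrite exprn_ge0// ltW.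
set Q := \sum_i g1 i * W g1 i + \sum_i g2 i * W g2 i.
set E1 := \sum_i et1 i * W g1 i + \sum_i et2 i * W g2 i.
set Wp1 := \sum_i ph i * W g1 i; set Wp2 := \sum_i ph i * W g2 i.
set SF := \sum_i \sum_j `|F i j|.
set L1 := \sum_i D1 i; set L2 := \sum_i D2 i.
have fluxE : \sum_i (((2 * om * (et1 i - al / s * g1 i - (ph i * h2 + th * g2 i)) + 2 * mu * sg * g1 i)
              * W g1 i + (2 * om * psi1 + 2 * mu * sg * h1) * D1 i) +
           ((2 * om * (et2 i - al / s * g2 i + (ph i * h1 + th * g1 i)) + 2 * mu * sg * g2 i)
              * W g2 i + (2 * om * psi2 + 2 * mu * sg * h2) * D2 i)) =
    2 * om * E1 + (2 * mu * sg - 2 * om * (al / s)) * Q + 2 * om * (h1 * Wp2 - h2 * Wp1)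
    + (2 * om * psi1 + 2 * mu * sg * h1) * L1 + (2 * om * psi2 + 2 * mu * sg * h2) * L2.
  (* Symmetry of A removes the gradient terms carrying the factor [th], which is unbounded in v. *)
  have S := sum_form_sym g1 g2.
  transitivity (2 * om * E1 + (2 * mu * sg - 2 * om * (al / s)) * Q
    + 2 * om * (h1 * Wp2 - h2 * Wp1)
    + 2 * om * th * (\sum_i g1 i * W g2 i - \sum_i g2 i * W g1 i)
    + (2 * om * psi1 + 2 * mu * sg * h1) * L1 + (2 * om * psi2 + 2 * mu * sg * h2) * L2);
    last by rewrite S; ring.
  rewrite /E1 /Q /Wp1 /Wp2 /L1 /L2 !(mulrBr, mulrDr, mulr_sumr) -!sumrN -!big_split /=.
  by apply: eq_bigr => i _; ring.
have eE : - \sum_i \sum_j e i j <=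
    - ((1 - 2 * al) * sg * Q + 2 * om * E1) + lam * om * SF.
  have -> : (1 - 2 * al) * sg * Q + 2 * om * E1 = \sum_i \sum_j a i j * ((1 - 2 * al) * sg * F i j +
     om * (et1 i * g1 j + g1 i * et1 j + (et2 i * g2 j + g2 i * et2 j))).
    have -> : 2 * om * E1 = om * (E1 + (\sum_i g1 i * W et1 i + \sum_i g2 i * W et2 i)).
      by rewrite -(sum_form_sym et1 g1) -(sum_form_sym et2 g2) -/E1; ring.
    rewrite /Q /E1 /W !mulrDr !mulr_sumr -!big_split /=; apply: eq_bigr => i _.
    rewrite !mulr_sumr -!big_split /=; apply: eq_bigr => j _; rewrite /F; ring.
  set B := (X in - X + _); set E := (X in - X <= _).
  suff : B - E <= lam * om * SF by lra.
  rewrite /B /E /SF mulr_sumr -sumrB.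
  apply: ler_sum => i _; rewrite mulr_sumr -sumrB; apply: ler_sum => j _.
  have := e_bound i j; rewrite distrC normrM (ger0_norm om0) mulrA.
  exact: le_trans (ler_norm _).
have QG : G / lam <= Q.
  have c1 := a_coercive g1; have c2 := a_coercive g2.
  rewrite /Q /G big_split /= mulrC mulrDr lerD//.
    apply: (le_trans c1); rewrite le_eqVlt; apply/orP; left; apply/eqP.
    apply: eq_bigr => i _; rewrite /W mulr_sumr; apply: eq_bigr => j _; ring.
  apply: (le_trans c2); rewrite le_eqVlt; apply/orP; left; apply/eqP.
  apply: eq_bigr => i _; rewrite /W mulr_sumr; apply: eq_bigr => j _; ring.
have ab := absorption QG cross_frequency_bound sum_normF_le.
rewrite -/Wp1 -/Wp2 -/SF in ab.
have {}ab := ler_wpM2l sg0 ab.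
rewrite fluxE.
(* The bound |X + Y|^2 >= 2 X . Y, with x = psi and y = P. *)
have sq1 (x y : R) : 2 * om * (x * (y - x)) <= om * y ^+ 2.
  rewrite -subr_ge0.
  have -> : om * y ^+ 2 - 2 * om * (x * (y - x)) = om * (x ^+ 2 + (y - x) ^+ 2) by ring.
  by rewrite mulr_ge0// addr_ge0// sqr_ge0.
(* The test against h. Young's inequality costs sg/s |h|^2, without a factor al, against a gain of 2
   al sg/s |h|^2. *)
have sq2 (x y : R) : 2 * sg * (x * y) - sg / s * x ^+ 2 <= om * y ^+ 2.
  rewrite -subr_ge0.
  have -> : om * y ^+ 2 - (2 * sg * (x * y) - sg / s * x ^+ 2) = sg / s * (x - s * y) ^+ 2.
    by rewrite /om; field; rewrite ?(gt_eqF l0) ?(gt_eqF s0).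
  by apply: mulr_ge0; [apply: divr_ge0 => //; exact: ltW|exact: sqr_ge0].
have A1 := sq1 psi1 P1; have A2 := sq1 psi2 P2.
have B1 := ler_wpM2l mu0 (sq2 h1 P1); have B2 := ler_wpM2l mu0 (sq2 h2 P2).
have -> : (1 + mu) * (om * (P1 ^+ 2 + P2 ^+ 2)) = om * P1 ^+ 2 + om * P2 ^+ 2 +
  (mu * (om * P1 ^+ 2) + mu * (om * P2 ^+ 2)) by ring.
apply: (le_trans _ (lerD (lerD A1 A2) (lerD B1 B2))).
apply: (@le_trans _ _ ((sg * G + al * (sg / s) * hh) / (32 * lam ^+ 2) +
  (2 * om * E1 + (2 * mu * sg - 2 * om * (al / s)) * Q + 2 * om * (h1 * Wp2 - h2 * Wp1)
    + (2 * om * psi1 + 2 * mu * sg * h1) * L1 + (2 * om * psi2 + 2 * mu * sg * h2) * L2 +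
   (- ((1 - 2 * al) * sg * Q + 2 * om * E1) + lam * om * SF +
    (((al + mu) * (- (2 * al) * (sg / s)) - kap * ((1 - 2 * al) * sg)) * hh +
     ((al + mu) * sg - kap * om) * (2 * (h1 * t1 + h2 * t2))))))).
  by rewrite lerD2l lerD2l lerD2r.
rewrite -subr_ge0; move: ab; rewrite -subr_ge0.
set lhs := (X in 0 <= X -> _); set rhs := (X in _ -> 0 <= X).
suff -> : rhs = lhs by [].
rewrite /lhs /rhs /P1 /P2 -/L1 -/L2 /psi1 /psi2 /om /hh; field.
by rewrite ?(gt_eqF l0) ?(gt_eqF s0).
Qed.

End pointwise_inequality.

(** * The a.e. divergence inequality *)

Section complex_parts.
Context {R : realType} {m n : nat}.
Local Notation ST := (R * 'rV[R]_m)%type.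
Implicit Types (h : ST -> R[i]) (z w : R[i]) (c : R).

Let ReD z w : complex.Re (z + w) = complex.Re z + complex.Re w.
Proof. by case: z w => [? ?] [? ?]. Qed.

Let ImD z w : complex.Im (z + w) = complex.Im z + complex.Im w.
Proof. by case: z w => [? ?] [? ?]. Qed.

Let Re_sum I (r : seq I) (F : I -> R[i]) :
  complex.Re (\sum_(i <- r) F i) = \sum_(i <- r) complex.Re (F i).
Proof. exact: (big_morph _ ReD erefl). Qed.

Let Im_sum I (r : seq I) (F : I -> R[i]) :
  complex.Im (\sum_(i <- r) F i) = \sum_(i <- r) complex.Im (F i).
Proof. exact: (big_morph _ ImD erefl). Qed.

Let Re_scale c z : complex.Re (c%:C%C * z) = c * complex.Re z.
Proof. by case: z => a b /=; ring. Qed.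

Let Im_scale c z : complex.Im (c%:C%C * z) = c * complex.Im z.
Proof. by case: z => a b /=; ring. Qed.

Let Re_rot c z : complex.Re ('i%C * c%:C%C * z) = - (c * complex.Im z).
Proof. by case: z => a b /=; ring. Qed.

Let Im_rot c z : complex.Im ('i%C * c%:C%C * z) = c * complex.Re z.
Proof. by case: z => a b /=; ring. Qed.

Let ReN z : complex.Re (- z) = - complex.Re z.
Proof. by case: z. Qed.

Let ImN z : complex.Im (- z) = - complex.Im z.
Proof. by case: z. Qed.

Definition conormal (A : ST -> 'M[R]_m) (f : ST -> R) i p : R :=
  \sum_j A p i j * 'D_(e_v j) f p.

Definition residual2 A (ph : 'I_m -> R -> R) (kap : R) h (p : ST) : R :=
  let h1 q := complex.Re (h q) in let h2 q := complex.Im (h q) in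
  let th := \sum_l ph l p.1 * p.2 0 l in
  ('D_e_t h1 p - th * h2 p + \sum_i 'D_(e_v i) (conormal A h1 i) p - kap * h1 p) ^+ 2 +
  ('D_e_t h2 p + th * h1 p + \sum_i 'D_(e_v i) (conormal A h2 i) p - kap * h2 p) ^+ 2.

Lemma normc2_Ptilde A (B1 : 'M[R]_(n, m)) (B2 : 'M[R]_n) (rho : 'cV[R]_n) h (p : ST) :
  normc2 (Ptilde A B1 B2 rho h p) =
  residual2 A (fun l t => frequency B1 B2 rho t l 0) (2^-1 * \tr B2) h p.
Proof.
rewrite /residual2 /normc2 /Ptilde /div_v_grad_v.
rewrite !(ReD, ImD, ReN, ImN, Re_rot, Im_rot, Re_scale, Im_scale, Re_sum, Im_sum).
congr (_ ^+ 2 + _ ^+ 2); congr (_ + _ + _ + _).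
  apply: eq_bigr => i _; rewrite /cderive /=; congr (derive _ _ _).
  apply/funext => q; rewrite Re_sum; apply: eq_bigr => j _.
  by rewrite Re_scale.
apply: eq_bigr => i _; rewrite /cderive /=; congr (derive _ _ _).
apply/funext => q; rewrite Im_sum; apply: eq_bigr => j _.
by rewrite Im_scale.
Qed.

End complex_parts.

Lemma measure_setU_null d (Y : measurableType d) (R : realType)
    (nu : {measure set Y -> \bar R}) (A B : set Y) :
  measurable A -> measurable B -> nu A = 0%E -> nu B = 0%E -> nu (A `|` B) = 0%E.
Proof.
move=> mA mB A0 B0; apply/negligibleP; first exact: measurableU.
by apply: negligibleU; apply/negligibleP.
Qed.

Section carleman.
Context {R : realType} {m : nat}.
Local Notation ST := (R * 'rV[R]_m)%type.
Local Notation X := (measurableTypeR R * m.-tuple (measurableTypeR R))%type.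
Local Notation mu := (@spacetime_measure R m).

Lemma null_set_union (I : finType) (N : I -> set X) :
  (forall i, measurable (N i)) -> (forall i, mu (N i) = 0%E) ->
  exists N' : set X, [/\ measurable N', mu N' = 0%E & forall i, N i `<=` N'].
Proof.
move=> mN N0.
suff [N' [mN' N0' NN']] : exists N' : set X, [/\ measurable N', mu N' = 0%E &
    forall i, i \in enum I -> N i `<=` N'].
  by exists N'; split => // i; apply: NN'; rewrite mem_enum.
elim: (enum I) => [|i r [N' [mN' N0' NN']]].
  by exists set0; split => //; exact: measure0.
exists (N i `|` N'); have mU : measurable (N i `|` N') by exact: measurableU.
split => //.
  exact: (measure_setU_null (mN i) mN' (N0 i) N0').
move=> j; rewrite inE => /predU1P[->|jr]; first exact: subsetUl.
by apply: subset_trans (@subsetUr _ _ _); exact: NN'.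
Qed.

Variables (S : set ST) (cS : compact S) (lam T t2 : R) (A : ST -> 'M[R]_m).
Hypotheses (lam1 : 1 < lam) (hA : elliptic_lipschitz lam T A) (t2T : t2 <= T)
  (St2 : S `<=` slab t2).

Let ST0 : S `<=` slab T.
Proof.
by move=> p /St2 /andP[p0 pt]; apply/andP; split => //; exact: lt_le_trans t2T.
Qed.

Let gradient_supported f i : smooth_supported S f ->
  smooth_supported S ('D_(e_v i) f).
Proof. exact: smooth_supported_derive. Qed.

Lemma lip_supported_conormal f u i : smooth_supported S f ->
  lip_supported S u (conormal A f i).
Proof.
move=> sf; apply: lip_supported_sum => j.
have sg := gradient_supported j sf.
apply: (lip_supported_coefficient lam1 hA cS ST0).
- exact: smooth_supported_continuous sg.
- exact: smooth_supported_lip.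
Qed.

(** The flux and A grad f are each Lipschitz along e_i, so each has its own null set of bad points.
    Off both, the product rule holds with the very derivative of A grad f that occurs in the
    operator. *)
Lemma conormal_flux (f G : ST -> R) (dG : 'I_m -> ST -> R) :
  smooth_supported S f -> (forall i, lip_supported S (e_v i) G) ->
  (forall i p, is_derive p (e_v i) G (dG i p)) ->
  exists (N : set X) (d : 'I_m -> X -> R), [/\ measurable N, mu N = 0%E,
    forall i, null_divergence (d i) &
    forall x i, ~ N x -> let p := spacetime_point x in
      d i x = dG i p * conormal A f i p + G p * 'D_(e_v i) (conormal A f i) p].
Proof.
move=> sf lG dGE.
have /choice[NW /choice[dW HW]] :=
  fun i => lip_supported_flux cS (lip_supported_conormal (e_v i) i sf).
have /choice[NP /choice[dP HP]] := fun i =>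
  lip_supported_flux cS (lip_supportedM (lG i) (lip_supported_conormal (e_v i) i sf)).
have [N1 [mN1 N10 NW1]] := @null_set_union _ NW
  (fun i => let: And4 H _ _ _ := HW i in H) (fun i => let: And4 _ H _ _ := HW i in H).
have [N2 [mN2 N20 NP2]] := @null_set_union _ NP
  (fun i => let: And4 H _ _ _ := HP i in H) (fun i => let: And4 _ H _ _ := HP i in H).
exists (N1 `|` N2), dP; have mU : measurable (N1 `|` N2) by exact: measurableU.
split => //.
- exact: (measure_setU_null mN1 mN2 N10 N20).
- by move=> i; have [_ _ H _] := HP i.
move=> x i Nx p.
have [_ _ _ HWi] := HW i; have [_ _ _ HPi] := HP i.
have x1 : ~ NW i x by move=> /NW1 H; apply: Nx; left.
have x2 : ~ NP i x by move=> /NP2 H; apply: Nx; right.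
have dWx := HWi x x1.
rewrite (@derive_val _ _ _ _ _ _ _ dWx).
exact: is_derive_uniq (HPi x x2) (is_derive_mul_fun (dGE i p) dWx).
Qed.

Variables (b al kap : R) (ph : 'I_m -> R -> R).
Hypotheses (m0 : (0 < m)%N) (b0 : 0 < b)
  (t2_small : (t2 + b) * (8 * m%:R * lam ^+ 2) <= 1)
  (al2 : 2 <= al) (alk : 2 * `|kap| <= al)
  (mph : forall l, measurable_fun [set: R] (ph l))
  (ph_small : forall t, 0 < t < t2 ->
     (t + b) ^+ 3 * (\sum_l ph l t ^+ 2) * (512 * m%:R ^+ 2 * lam ^+ 5) <= al).

Let sg (t : R) := (t + b) `^ (- (2 * al)).
Let om (t : R) := (t + b) `^ (- (2 * al - 1)).
Let mu0 := 1 / (8 * lam ^+ 2).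

Let omE t : 0 < t + b -> om t = sg t * (t + b).
Proof.
move=> tb; rewrite /om /sg; have -> : - (2 * al - 1) = - (2 * al) + 1 by ring.
rewrite powRD; last by rewrite (gt_eqF tb) implybT.
by rewrite powRr1// ltW.
Qed.

Let sg1E t : 0 < t + b -> (t + b) `^ (- (2 * al) - 1) = sg t / (t + b).
Proof.
move=> tb; rewrite /sg powRD; last by rewrite (gt_eqF tb) implybT.
by rewrite (powRN _ 1) powRr1// ltW.
Qed.

Let dsgE t : 0 < t + b -> is_derive t 1 sg (- (2 * al) * (sg t / (t + b))).
Proof. by move=> tb; rewrite -sg1E//; exact: is_derive_power_weight. Qed.

Let domE t : 0 < t + b -> is_derive t 1 om ((1 - 2 * al) * sg t).
Proof.
move=> tb; have H := is_derive_power_weight (- (2 * al - 1)) tb.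
have E1 : - (2 * al - 1) - 1 = - (2 * al) by ring.
have -> : 1 - 2 * al = - (2 * al - 1) by ring.
by move: H; rewrite E1.
Qed.

Let al_ge : 0 <= 2 * al /\ 0 <= 2 * al - 1.
Proof. by have H := al2; split; lra. Qed.

(** From [ph_small] and s >= b. The bound depends on b, which is harmless: it only makes the fluxes
    admissible. *)
Let bounded_frequency l : exists B, forall t, 0 < t < t2 -> `|ph l t| <= B.
Proof.
have lam1' := lam1; have l0 : 0 < lam by lra.
have M0 : 0 < m%:R :> R by rewrite ltr0n.
pose K := b ^+ 3 * (512 * m%:R ^+ 2 * lam ^+ 5).
have K0 : 0 < K.
  apply: mulr_gt0; first exact: exprn_gt0.
  apply: mulr_gt0; last exact: exprn_gt0.
  by apply: mulr_gt0; [rewrite ltr0n|exact: (exprn_gt0 2 M0)].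
exists (al / K + 1) => t tI.
have phl : ph l t ^+ 2 <= \sum_k ph k t ^+ 2.
  rewrite (bigD1 l)//= lerDl sumr_ge0// => k _; exact: sqr_ge0.
have p2 : ph l t ^+ 2 <= al / K.
  rewrite ler_pdivlMr//; apply: le_trans (ph_small tI).
  have -> : ph l t ^+ 2 * K = b ^+ 3 * ph l t ^+ 2 * (512 * m%:R ^+ 2 * lam ^+ 5).
    by rewrite /K; ring.
  apply: ler_wpM2r; first by rewrite !mulr_ge0 ?exprn_ge0 ?ler0n ?(ltW l0).
  apply: ler_pM; [by rewrite exprn_ge0// ltW|exact: sqr_ge0| |exact: phl].
  have /andP[tt _] := tI.
  by rewrite lerXn2r ?nnegrE// ?lerDr ?(ltW b0) ?(ltW tt)// addr_ge0// ltW.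
apply: (@le_trans _ _ (ph l t ^+ 2 + 1)); last by rewrite lerD2r.
rewrite -(real_normK (num_real (ph l t))).
by have := sqr_ge0 (`|ph l t| - 2^-1); set z := `|ph l t|; rewrite !expr2; lra.
Qed.

Variable h : ST -> R[i].
Let h1 q := complex.Re (h q).
Let h2 q := complex.Im (h q).
Hypotheses (sh1 : smooth_supported S (fun q => complex.Re (h q)))
  (sh2 : smooth_supported S (fun q => complex.Im (h q))).

Let F i j (p : ST) : R := 'D_(e_v i) h1 p * 'D_(e_v j) h1 p +
  'D_(e_v i) h2 p * 'D_(e_v j) h2 p.
Let hh (p : ST) : R := h1 p * h1 p + h2 p * h2 p.

Let lip_F u i j : lip_supported S u (F i j).
Proof.
have s1 k := gradient_supported k sh1; have s2 k := gradient_supported k sh2.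
by apply: lip_supportedD; apply: lip_supportedM; exact: smooth_supported_lip.
Qed.

Let F_continuous i j : continuous (F i j).
Proof.
have s1 k : continuous ('D_(e_v k) h1).
  exact: smooth_supported_continuous (gradient_supported k sh1).
have s2 k : continuous ('D_(e_v k) h2).
  exact: smooth_supported_continuous (gradient_supported k sh2).
move=> p; exact: (cvgD (cvgM (s1 i p) (s1 j p)) (cvgM (s2 i p) (s2 j p))).
Qed.

Let is_derive_smooth u f p : smooth_supported S f ->
  is_derive p u f ('D_u f p).
Proof.
by move=> sf; apply: derivableP; exact: (@smooth_supported_derivable R m S f u p sf).
Qed.

Let dF i j p := ('D_(e_v i) ('D_e_t h1) p * 'D_(e_v j) h1 p +
    'D_(e_v i) h1 p * 'D_(e_v j) ('D_e_t h1) p) +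
  ('D_(e_v i) ('D_e_t h2) p * 'D_(e_v j) h2 p +
    'D_(e_v i) h2 p * 'D_(e_v j) ('D_e_t h2) p).

(** The mixed derivatives are written with the time derivative taken first, as the multiplier d_t h
    produces them in the spatial fluxes, so that the two families cancel. *)
Let is_derive_F i j p : is_derive p e_t (F i j) (dF i j p).
Proof.
have H f k : smooth_supported S f ->
    is_derive p e_t ('D_(e_v k) f) ('D_(e_v k) ('D_e_t f) p).
  move=> sf; rewrite (smooth_supported_swap cS e_t (e_v k) p sf).
  exact: is_derive_smooth (gradient_supported k sf).
by apply: is_derive_add_fun; apply: is_derive_mul_fun; exact: H.
Qed.

Let time_flux i j : exists (N : set X) (d : X -> R), [/\ measurable N, mu N = 0%E,
  null_divergence d & forall x, ~ N x ->
    is_derive (spacetime_point x : ST) e_t (fun q => A q i j * (om q.1 * F i j q)) (d x)].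
Proof.
apply: (lip_supported_flux cS).
have -> : (fun q => A q i j * (om q.1 * F i j q)) =
    (fun q : ST => om q.1 * (A q i j * F i j q)).
  by apply/funext => q; rewrite mulrCA.
apply: (lip_supported_power b0 cS St2); first by have [] := al_ge.
apply: (lip_supported_coefficient lam1 hA cS ST0) => //.
Qed.

(** The exact time derivatives in |h|^2: al comes from pairing X g with (al/s) g, [mu0] from the
    test against h, and -kap from pairing X g with the trace term. *)
Let energy_flux : exists (N : set X) (d : X -> R), [/\ measurable N, mu N = 0%E,
  null_divergence d & forall x, ~ N x ->
    is_derive (spacetime_point x : ST) e_t
      (fun q => (al + mu0) * (sg q.1 * hh q) + (- kap) * (om q.1 * hh q)) (d x)].
Proof.
have [a1 a2] := al_ge.
have lh : lip_supported S e_t hh.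
  by apply: lip_supportedD; apply: lip_supportedM; exact: smooth_supported_lip.
apply: (lip_supported_flux cS); apply: lip_supportedD; apply: lip_supported_scale.
  exact: (lip_supported_power b0 cS St2).
exact: (lip_supported_power b0 cS St2).
Qed.

(** This is 2 om psi + 2 mu0 sg h: since om = sg s, the part -2 om (al/s) h of 2 om psi equals -2 al
    sg h. The sign eps is that of the coupling by the drift, -1 for the real part and 1 for the
    imaginary part. *)
Let multiplier (f f' : ST -> R) (eps : R) : ST -> R :=
  flux_multiplier ('D_e_t f) f f' (fun t => 2 * om t)
    (fun t => (2 * mu0 - 2 * al) * sg t) (fun l t => eps * (2 * om t * ph l t)).

Let component_flux f f' eps : smooth_supported S f -> smooth_supported S f' ->
  exists (N : set X) (d : 'I_m -> X -> R), [/\ measurable N, mu N = 0%E,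
    forall i, null_divergence (d i) &
    forall x i, ~ N x -> let p := spacetime_point x in
      let th := \sum_l ph l p.1 * p.2 0 l in
      d i x = (2 * om p.1 * 'D_(e_v i) ('D_e_t f) p +
          (2 * mu0 - 2 * al) * sg p.1 * 'D_(e_v i) f p +
          eps * 2 * om p.1 * (ph i p.1 * f' p + th * 'D_(e_v i) f' p))
        * conormal A f i p +
      (2 * om p.1 * 'D_e_t f p + (2 * mu0 - 2 * al) * sg p.1 * f p +
          eps * 2 * om p.1 * (th * f' p)) * 'D_(e_v i) (conormal A f i) p].
Proof.
move=> sf sf'; have [a1 a2] := al_ge.
have st := smooth_supported_derive cS e_t sf.
have msg : measurable_fun [set: R] sg by exact: measurable_power_weight.
have mom : measurable_fun [set: R] om by exact: measurable_power_weight.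
have mc1 : measurable_fun [set: R] (fun t => 2 * om t).
  by apply: measurable_funM => //; exact: measurable_cst.
have mc2 : measurable_fun [set: R] (fun t => (2 * mu0 - 2 * al) * sg t).
  by apply: measurable_funM => //; exact: measurable_cst.
have mc3 l : measurable_fun [set: R] (fun t => eps * (2 * om t * ph l t)).
  apply: measurable_funM; first exact: measurable_cst.
  by apply: measurable_funM; [exact: mc1|exact: mph].
have [Bs sB] := power_weight_bounded b0 t2 a1.
have [Bo oB] := power_weight_bounded b0 t2 a2.
have bc1 : exists B, forall t, 0 < t < t2 -> `|2 * om t| <= B.
  by exists (`|2| * Bo) => t tI; rewrite normrM ler_wpM2l// oB.
have bc2 : exists B, forall t, 0 < t < t2 -> `|(2 * mu0 - 2 * al) * sg t| <= B.
  by exists (`|2 * mu0 - 2 * al| * Bs) => t tI; rewrite normrM ler_wpM2l// sB.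
have bc3 l : exists B, forall t, 0 < t < t2 -> `|eps * (2 * om t * ph l t)| <= B.
  have [Bp pB] := bounded_frequency l; have [B1 b1] := bc1.
  exists (`|eps| * (B1 * Bp)) => t tI; rewrite normrM ler_wpM2l// normrM.
  by apply: ler_pM => //; [exact: b1|exact: pB].
have lG i := lip_supported_flux_multiplier cS St2 st sf sf' mc1 mc2 mc3 bc1 bc2 bc3 i.
have dG i p := is_derive_flux_multiplier (fun t => 2 * om t)
  (fun t => (2 * mu0 - 2 * al) * sg t) (fun l t => eps * (2 * om t * ph l t)) st sf sf' i p.
have [N [d [mN N0 nd dE]]] := conormal_flux sf lG dG.
exists N, d; split => // x i Nx p th; rewrite (dE x i Nx).
have thE : \sum_l eps * (2 * om p.1 * ph l p.1) * p.2 0 l = eps * 2 * om p.1 * th.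
  by rewrite /th mulr_sumr; apply: eq_bigr => l _; ring.
have thE' : \sum_l eps * (2 * om p.1 * ph l p.1) * (p.2 0 l * f' p) =
    eps * 2 * om p.1 * (th * f' p).
  by rewrite /th mulr_suml mulr_sumr; apply: eq_bigr => l _; ring.
rewrite /flux_multiplier -/p thE thE'; congr (_ * _ + _ * _).
by congr (_ + _); ring.
Qed.

Let density (p : ST) : R := sg p.1 * grad_v2 h p +
  al * ((p.1 + b) `^ (- (2 * al) - 1) * normc2 (h p)).

Lemma lip_supported_density c : 0 <= c ->
  lip_supported S e_t (fun p => (p.1 + b) `^ (- c) * grad_v2 h p) /\
  lip_supported S e_t (fun p => (p.1 + b) `^ (- c) * normc2 (h p)).
Proof.
move=> c0; split; apply: (lip_supported_power b0 cS St2 c0).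
  have -> : grad_v2 h = (fun p => \sum_i F i i p).
    by apply/funext => p; apply: eq_bigr => i _; rewrite /F -!expr2.
  by apply: lip_supported_sum => i; exact: lip_F.
have -> : (fun p => normc2 (h p)) = hh.
  by apply/funext => p; rewrite /hh -!expr2.
by apply: lip_supportedD; apply: lip_supportedM; exact: smooth_supported_lip.
Qed.

Local Notation remainder p := (residual2 A ph kap h p).

(** On S this is the pointwise inequality off the union of five null sets: two for the spatial
    fluxes, two for the time fluxes, one for the bound on the derivatives of A. Off S, which is
    closed, every flux vanishes near the point. *)
Lemma carleman_divergence : exists (N : set X) (d : X -> R),
  [/\ measurable N, mu N = 0%E, null_divergence d,
    forall x, ~ N x -> S (spacetime_point x) ->
      density (spacetime_point x) / (36 * lam ^+ 2) + d x <=
      om x.1 * remainder (spacetime_point x) &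
    forall x, ~ N x -> ~ S (spacetime_point x) -> d x = 0].
Proof.
have lam1' := lam1; have l0 : 0 < lam by lra.
have [N1 [d1 [mN1 N10 nd1 d1E]]] := component_flux (-1) sh1 sh2.
have [N2 [d2 [mN2 N20 nd2 d2E]]] := component_flux 1 sh2 sh1.
have /choice[N3 /choice[e He]] := fun ij : 'I_m * 'I_m => time_flux ij.1 ij.2.
have [N4 [dU [mN4 N40 ndU dUE]]] := energy_flux.
have [N3' [mN3 N30 N3N]] := @null_set_union _ N3
  (fun i => let: And4 H _ _ _ := He i in H) (fun i => let: And4 _ H _ _ := He i in H).
have [_ _ _ Ader] := hA.
have /choice[N5 H5] := fun ij : 'I_m * 'I_m => Ader ij.1 ij.2.
have [N5' [mN5 N50 N5N]] := @null_set_union _ N5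
  (fun i => let: And3 H _ _ := H5 i in H) (fun i => let: And3 _ H _ := H5 i in H).
pose NN (k : 'I_5) := match val k with 0 => N1 | 1 => N2 | 2 => N3' | 3 => N4 | _ => N5' end.
have [N [mN N0 NNN]] : exists N' : set X, [/\ measurable N', mu N' = 0%E & forall i, NN i `<=` N'].
  by apply: null_set_union => -[[|[|[|[|[|]]]]] ?].
pose dtot x := \sum_i (d1 i x + d2 i x) +
  ((-1) * \sum_i \sum_j e (i, j) x + dU x).
(* The factor 8/9 divides out 1 + mu0 <= 9/8, and turns 32 into 36. *)
exists N, (fun x => 8 / 9 * dtot x); split => //.
- apply: null_divergence_scale; apply: null_divergenceD.
    by apply: null_divergence_sum => i; apply: null_divergenceD.
  apply: null_divergenceD => //; apply: null_divergence_scale.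
  apply: null_divergence_sum => i; apply: null_divergence_sum => j.
  by have [_ _ H _] := He (i, j).
- move=> x Nx Sx; set p := spacetime_point x in Sx *.
  have x1 : ~ N1 x by move=> H; apply: Nx; exact: (NNN (Ordinal (isT : 0 < 5)%N)).
  have x2 : ~ N2 x by move=> H; apply: Nx; exact: (NNN (Ordinal (isT : 1 < 5)%N)).
  have x3 : ~ N3' x by move=> H; apply: Nx; exact: (NNN (Ordinal (isT : 2 < 5)%N)).
  have x4 : ~ N4 x by move=> H; apply: Nx; exact: (NNN (Ordinal (isT : 3 < 5)%N)).
  have x5 : ~ N5' x by move=> H; apply: Nx; exact: (NNN (Ordinal (isT : 4 < 5)%N)).
  have pT : slab T p by exact: ST0.
  have /andP[p0 pt2] := St2 Sx.
  have s0 : 0 < p.1 + b by rewrite addr_gt0.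
  have s_small : (p.1 + b) * (8 * m%:R * lam ^+ 2) <= 1.
    apply: le_trans t2_small; apply: ler_wpM2r.
      by rewrite !mulr_ge0 ?exprn_ge0 ?ler0n ?(ltW l0).
    by rewrite lerD2r ltW.
  have sg0 : 0 <= sg p.1 by exact: powR_ge0.
  have omp := omE s0.
  have e_bound i j : `|e (i, j) x - A p i j * ((1 - 2 * al) * sg p.1 * F i j p +
      sg p.1 * (p.1 + b) * dF i j p)| <= lam * `|sg p.1 * (p.1 + b) * F i j p|.
    have [_ _ _ /(_ x)] := He (i, j) => /(_ (fun H => x3 (N3N _ _ H))) de.
    have dom : is_derive p e_t (fun q : ST => om q.1 * F i j q)
        ((1 - 2 * al) * sg p.1 * F i j p + om p.1 * dF i j p).
      exact: is_derive_mul_fun (is_derive_time (domE s0)) (is_derive_F i j p).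
    have Hb : `|'D_e_t (fun q : ST => A q i j) p| <= lam.
      have [_ _ H] := H5 (i, j).
      have Hx : ~ ~ (slab T p -> `|'D_e_t (fun q => A q i j : R) p| +
          Num.sqrt (\sum_(k < m) 'D_(e_v k) (fun q => A q i j : R) p ^+ 2) <= lam).
        by move=> nH; apply: x5; apply: (N5N (i, j)); apply: H; exact: nH.
      move/contrapT : Hx => /(_ pT); apply: le_trans.
      by rewrite lerDl sqrtr_ge0.
    have Hd := @derive_factor_bound R _ (fun q : ST => A q i j)
      (fun q : ST => om q.1 * F i j q) e_t p _ _ lam
      (@coefficient_continuous R m lam T A hA i j p pT) de dom Hb.
    by rewrite -omp; exact: Hd.
  have := @carleman_pointwise R m lam (fun i j => A p i j)
    (fun i j => coefficient_sym hA i j pT)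
    (fun i j => coefficient_bound lam1 hA i j pT)
    (fun y => proj1 (andP (coefficient_elliptic hA y pT)))
    al kap (p.1 + b) (sg p.1) m0 lam1 s0 s_small sg0 al2 alk
    (h1 p) (h2 p) ('D_e_t h1 p) ('D_e_t h2 p) (\sum_l ph l p.1 * p.2 0 l)
    (fun i => 'D_(e_v i) h1 p) (fun i => 'D_(e_v i) h2 p)
    (fun i => 'D_(e_v i) ('D_e_t h1) p) (fun i => 'D_(e_v i) ('D_e_t h2) p)
    (fun i => 'D_(e_v i) (conormal A h1 i) p) (fun i => 'D_(e_v i) (conormal A h2 i) p)
    (fun i => ph i p.1) (ph_small (St2 Sx)) (fun i j => e (i, j) x) e_bound.
  rewrite -/(remainder p).
  set lhs1 := (X in X / _ + _ <= _); set dd := (X in _ + X <= _).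
  have -> : density p = lhs1.
    rewrite /density /lhs1 sg1E// /grad_v2 /normc2 /= mulrA.
    by rewrite /h1 /h2.
  have -> : dd = dtot x.
    rewrite /dd /dtot; congr (_ + _).
      apply: eq_bigr => i _.
      rewrite (d1E x i x1) (d2E x i x2) -/p omp /conormal.
      by congr (_ + _); congr (_ * _ + _ * _); rewrite /mu0 /=; field; rewrite ?(gt_eqF s0) ?(gt_eqF l0).
    rewrite mulN1r; congr (_ + _).
    have dhh : is_derive p e_t hh (('D_e_t h1 p * h1 p + h1 p * 'D_e_t h1 p) +
        ('D_e_t h2 p * h2 p + h2 p * 'D_e_t h2 p)).
      apply: is_derive_add_fun; apply: is_derive_mul_fun; exact: is_derive_smooth.
    have H1 := is_derive_scale_fun (al + mu0)
      (is_derive_mul_fun (is_derive_time (dsgE s0)) dhh).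
    have H2 := is_derive_scale_fun (- kap)
      (is_derive_mul_fun (is_derive_time (domE s0)) dhh).
    rewrite (is_derive_uniq (dUE x x4) (is_derive_add_fun H1 H2)) omp /hh /mu0.
    ring.
  rewrite -omp => H.
  have mu8 : mu0 <= 1 / 8.
    rewrite /mu0 !div1r lef_pV2 ?posrE// ?mulr_gt0 ?exprn_gt0//.
    by rewrite ler_peMr// expr_ge1// ltW.
  have om0 : 0 <= om p.1 * remainder p.
    by rewrite mulr_ge0 ?powR_ge0// addr_ge0 ?sqr_ge0.
  have {}H : lhs1 / (32 * lam ^+ 2) + dtot x <= 9 / 8 * (om p.1 * remainder p).
    apply: (le_trans H); apply: ler_wpM2r => //.
    by rewrite -/mu0; lra.
  have -> : lhs1 / (36 * lam ^+ 2) = 8 / 9 * (lhs1 / (32 * lam ^+ 2)).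
    by field; rewrite gt_eqF.
  rewrite -mulrDr.
  have := ler_wpM2l (_ : 0 <= (8 / 9 : R)) H => /(_ _)/le_trans; apply; first lra.
  by rewrite mulrA (_ : 8 / 9 * (9 / 8) = 1) ?mul1r//; field.
move=> x Nx Sx; set p := spacetime_point x in Sx *.
have x1 : ~ N1 x by move=> H; apply: Nx; exact: (NNN (Ordinal (isT : 0 < 5)%N)).
have x2 : ~ N2 x by move=> H; apply: Nx; exact: (NNN (Ordinal (isT : 1 < 5)%N)).
have x3 : ~ N3' x by move=> H; apply: Nx; exact: (NNN (Ordinal (isT : 2 < 5)%N)).
have x4 : ~ N4 x by move=> H; apply: Nx; exact: (NNN (Ordinal (isT : 3 < 5)%N)).
have z f q : smooth_supported S f -> ~ S q -> f q = 0 by move=> [_ f0]; exact: f0.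
have zc f i : smooth_supported S f -> conormal A f i p = 0.
  move=> sf; rewrite /conormal big1// => j _.
  by rewrite (z _ _ (gradient_supported j sf))// mulr0.
have clS := compact_support_closed cS.
have ze i j : e (i, j) x = 0.
  have [_ _ _ /(_ x)] := He (i, j) => /(_ (fun H => x3 (N3N _ _ H))) de.
  apply: (is_derive_uniq de); apply: (is_derive_off_support _ clS) => // q Sq.
  by have [_ F0 _ _] := lip_F e_t i j; rewrite /= F0// !mulr0.
have zU : dU x = 0.
  apply: (is_derive_uniq (dUE x x4)); apply: (is_derive_off_support _ clS) => // q Sq.
  have q1 : h1 q = 0 := z _ _ sh1 Sq; have q2 : h2 q = 0 := z _ _ sh2 Sq.
  by rewrite /hh q1 q2 !(mulr0, addr0).
have zd f i : smooth_supported S f -> 'D_(e_v i) (conormal A f i) p = 0.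
  move=> sf; apply: (@derive_val _ _ _ _ _ _ _ _).
  apply: (is_derive_off_support _ clS) => // q Sq.
  by have [_ F0 _ _] := lip_supported_conormal e_t i sf; exact: F0.
rewrite /dtot zU addr0 big1 => [|i _]; last first.
  rewrite (d1E x i x1) (d2E x i x2) -/p (zc h1 i sh1) (zc h2 i sh2).
  by rewrite (zd h1 i sh1) (zd h2 i sh2) !mulr0 !addr0.
rewrite big1 => [|i _]; last by rewrite big1.
by rewrite !(mulr0, addr0).
Qed.

End carleman.

(** * The Carleman estimate *)

Theorem proposition1p6 (R : realType) (m n : nat) (hm : (1 <= m)%N)
    (hn : (1 <= n)%N) (lam : R) (hlam : 1 < lam)
    (B1 : 'M[R]_(n, m)) (B2 : 'M[R]_n) (hB : kalman B1 B2) :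
  exists C alpha0 c0 eps0 : R,
    [/\ 1 <= C, 1 < alpha0, 0 < c0 < 1 & 0 < eps0 < 1] /\
    forall (T : R) (A : R * 'rV[R]_m -> 'M[R]_m),
      0 < T -> elliptic_lipschitz lam T A ->
    forall (alpha t2 b : R),
      alpha0 <= alpha ->
      0 < t2 <= Num.min (c0 * lam ^- 2) T ->
      0 < b <= t2 ->
    forall rho : 'cV[R]_n,
      (ereal_sup [set ((t + b) ^+ 3
            * (\sum_(i < m) frequency B1 B2 rho t i 0 ^+ 2))%R%:E
          | t in `]0%R, t2[ ] <= (eps0 * alpha)%R%:E)%E ->
    forall h : R * 'rV[R]_m -> R[i],
      test_function t2 h ->
      (int_slab t2 (fun p => ((p.1 + b) `^ (- (2 * alpha)) * grad_v2 h p)%R%:E)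
       + alpha%:E *
         int_slab t2 (fun p => ((p.1 + b) `^ (- (2 * alpha) - 1)
                                * normc2 (h p))%R%:E)
       <= C%:E *
         int_slab t2 (fun p => ((p.1 + b) `^ (- (2 * alpha) + 1)
                                * normc2 (Ptilde A B1 B2 rho h p))%R%:E))%E.
Proof.
have l0 : 0 < lam by lra.
have lam2 : 1 <= lam ^+ 2 by rewrite expr_ge1// ltW.
have lam5 : 1 <= lam ^+ 5 by rewrite expr_ge1// ltW.
have M1 : 1 <= m%:R :> R by rewrite ler1n.
have M2 : 1 <= (m%:R : R) ^+ 2 by rewrite expr_ge1.
pose kap := 2^-1 * \tr B2.
pose Keps := 512 * m%:R ^+ 2 * lam ^+ 5.
have Keps1 : 1 < Keps.
  have : 1 <= m%:R ^+ 2 * lam ^+ 5 by rewrite -[leLHS]mulr1 ler_pM.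
  by rewrite /Keps -mulrA; lra.
have C1 : 1 <= 36 * lam ^+ 2 by lra.
have C0 : 0 < 36 * lam ^+ 2 by lra.
(* The second value yields both al >= 2 and al >= 2 |kap|; the third gives t + b <= 2 t2 <= 1/(8 m
   lam^2); the fourth is the reciprocal of the constant that the frequency bound requires. *)
exists (36 * lam ^+ 2), (2 + 2 * `|kap|), (16 * m%:R)^-1, Keps^-1; split.
  split => //.
  - by have : 0 <= `|kap| by []; lra.
  - by rewrite invr_gt0 invf_lt1 ?mulr_gt0//; lra.
  - by rewrite invr_gt0 invf_lt1 //; lra.
move=> T A T0 hA al t2 b hal /andP[t20]; rewrite le_min => /andP[t2c t2T] /andP[b0 bt2].
move=> rho hsup h [sm1 sm2 cS St2].
set S := closure _ in cS St2.
have hS p : ~ S p -> h p = 0.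
  move=> Sp; apply/eqP; apply: contra_notT Sp => hp.
  by apply: subset_closure.
have sh1 : smooth_supported S (fun q => complex.Re (h q)).
  by split => // p /hS ->.
have sh2 : smooth_supported S (fun q => complex.Im (h q)).
  by split => // p /hS ->.
have kap0 : 0 <= `|kap| by [].
have al2 : 2 <= al by lra.
have alk : 2 * `|kap| <= al by lra.
have al0 : 0 <= al by lra.
have t2_small : (t2 + b) * (8 * m%:R * lam ^+ 2) <= 1.
  have E : (16 * m%:R)^-1 * lam ^- 2 * (16 * m%:R * lam ^+ 2) = 1.
    by field; rewrite (gt_eqF l0) /= gt_eqF//; lra.
  have P : 0 <= 16 * m%:R * lam ^+ 2 by rewrite !mulr_ge0//; lra.
  have := ler_wpM2r P t2c; rewrite E; apply: le_trans.
  have P8 : 0 <= 8 * m%:R * lam ^+ 2 by rewrite !mulr_ge0//; lra.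
  apply: (@le_trans _ _ ((t2 + t2) * (8 * m%:R * lam ^+ 2))).
    by apply: ler_wpM2r => //; rewrite lerD2l.
  by rewrite le_eqVlt; apply/orP; left; apply/eqP; ring.
pose ph (l : 'I_m) (t : R) : R := frequency B1 B2 rho t l 0.
have ph_small t : 0 < t < t2 -> (t + b) ^+ 3 * (\sum_l ph l t ^+ 2) * Keps <= al.
  move=> tI; rewrite -ler_pdivlMr; last by lra.
  rewrite [leRHS]mulrC -lee_fin; apply: le_trans hsup.
  have tI' : t \in `]0, t2[ by rewrite in_itv.
  by apply: ereal_sup_ubound; exists t; [exact: tI'|].
have mph l : measurable_fun [set: R] (ph l) by exact: measurable_frequency.
have [N [d [mN N0 nd Hin Hout]]] :=
  carleman_divergence cS hlam hA t2T St2 hm b0 t2_small al2 alk mph ph_small sh1 sh2.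
have e1 : 0 <= 2 * al by lra.
have e2 : 0 <= 2 * al + 1 by lra.
have [lf1 _] := lip_supported_density cS St2 b0 sh1 sh2 e1.
have [_ lf2] := lip_supported_density cS St2 b0 sh1 sh2 e2.
have expE : - (2 * al + 1) = - (2 * al) - 1 by ring.
rewrite expE in lf2.
set g1 := (fun p => _) in lf1; set g2 := (fun p => _) in lf2.
pose X := (measurableTypeR R * m.-tuple (measurableTypeR R))%type.
pose f1 (x : X) := g1 (spacetime_point x); pose f2 (x : X) := g2 (spacetime_point x).
have [mf1 f1S _ _] := lf1; have [mf2 f2S _ _] := lf2.
have if1 := lip_supported_integrable cS lf1.
have if2 := lip_supported_integrable cS lf2.
have normc2_ge0 z : 0 <= normc2 z by rewrite addr_ge0 ?sqr_ge0.
have f10 x : 0 <= f1 x.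
  apply: mulr_ge0; first exact: powR_ge0.
  by apply: sumr_ge0 => i _; exact: normc2_ge0.
have f20 x : 0 <= f2 x.
  by apply: mulr_ge0; [exact: powR_ge0|exact: normc2_ge0].
have out (x : X) : ~ 0 < x.1 < t2 -> ~ S (spacetime_point x) by move=> xt /St2.
have I1 := ge0_slab_integral mf1 f10 (fun x xt => f1S _ (out x xt)).
have I2 := ge0_slab_integral mf2 f20 (fun x xt => f2S _ (out x xt)).
rewrite -[int_slab t2 _ in leLHS]/(\int[lebesgue_measure]_(t in `]0%R, t2[)
  \int[lebesgue_tuple m]_x (f1 (t, x))%:E)%E I1.
rewrite -[int_slab t2 _ in leLHS]/(\int[lebesgue_measure]_(t in `]0%R, t2[)
  \int[lebesgue_tuple m]_x (f2 (t, x))%:E)%E I2.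
pose C := 36 * lam ^+ 2.
(* The constant is put on the side whose integrand is known to be integrable, so that none has to be
   taken out of the integral of [E]. *)
pose LH (x : X) := C^-1 * (f1 x + al * f2 x).
have mLH : measurable_fun setT LH.
  apply: measurable_funM; first exact: measurable_cst.
  apply: measurable_funD => //.
  by apply: measurable_funM => //; exact: measurable_cst.
have LH0 x : 0 <= LH x.
  apply: mulr_ge0; first by rewrite invr_ge0; exact: ltW C0.
  by apply: addr_ge0 => //; apply: mulr_ge0.
have iaf2 := integrableZl measurableT al if2.
have iD := integrableD measurableT if1 iaf2.
have iLH : (@spacetime_measure R m).-integrable setT (EFin \o LH).
  exact: (integrableZl measurableT C^-1 iD).
pose E (x : X) := (x.1 + b) `^ (- (2 * al) + 1) *
  normc2 (Ptilde A B1 B2 rho h (spacetime_point x)).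
have E0 x : 0 <= E x.
  by apply: mulr_ge0; [exact: powR_ge0|exact: normc2_ge0].
have LHout x : ~ S (spacetime_point x) -> LH x = 0.
  by move=> xS; rewrite /LH /f1 /f2 f1S// f2S// mulr0 addr0 mulr0.
have key := @slab_integral_le R m t2 LH d N E mLH LH0 iLH nd mN N0 E0.
have {}key : (\int[@spacetime_measure R m]_x (LH x)%:E <= \int[lebesgue_measure]_(t in `]0%R, t2[)
    \int[lebesgue_tuple m]_x (E (t, x))%:E)%E.
  apply: key => x Nx xt.
    have [Sx|Sx] := pselect (S (spacetime_point x)); last first.
      by rewrite LHout// Hout// addr0.
    have := Hin x Nx Sx; rewrite /E normc2_Ptilde.
    have -> : - (2 * al) + 1 = - (2 * al - 1) by ring.
    by rewrite /LH mulrC.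
  by rewrite LHout ?Hout ?addr0//; exact: out.
have -> : (\int[@spacetime_measure R m]_x (f1 x)%:E +
    al%:E * \int[@spacetime_measure R m]_x (f2 x)%:E =
    C%:E * \int[@spacetime_measure R m]_x (LH x)%:E)%E.
  have -> : (\int[@spacetime_measure R m]_x (LH x)%:E =
      C^-1%:E * \int[@spacetime_measure R m]_x ((f1 x)%:E + al%:E * (f2 x)%:E))%E.
    by rewrite -integralZl.
  rewrite integralD// integralZl// muleA -EFinM mulfV ?mul1e//.
  by rewrite gt_eqF.
by apply: lee_wpmul2l => //; rewrite lee_fin ltW.
Qed.
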